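(* $\mathcal{P}=\bigoplus_{n\ge0}\mathcal{P}_n$ is a Hopf sub-algebra of $(\mathcal{D},\star,\downarrow)$. Furthermore, the elements $\tilde\Xi^q$, $q\in\mathbb{N}^*$ odd, constitute a linear basis of $\mathcal{P}$, and $$\tilde\Xi^r\star\tilde\Xi^q=\tilde\Xi^{r.q}$$ for all $q,r\in\mathbb{N}^*$, while $$\tilde\Xi^n\!\downarrow\;=\sum_{k=0}^n\tilde\Xi^k\otimes\tilde\Xi^{n-k}$$ for all $n\in\mathbb{N}$, where $\tilde\Xi^0$ is the empty permutation. In particular, $(\mathcal{P},\star)$ is a polynomial ring in the non-commuting variables (i.e. is freely generated as an associative algebra with identity by) $$\tfrac12\tilde\Xi^n=\sum_{\pi\in S_n,\ \mathrm{Peak}(\pi)=\emptyset}\pi\qquad(n\in\mathbb{N}\text{ odd}).$$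
   Context: $K$ is a field of characteristic $0$. Permutations act on the right ($i\pi$ is the image of $i$). For $\pi\in S_n$: $\mathrm{Des}(\pi)=\{1\le i\le n-1\mid i\pi>(i+1)\pi\}$, $\mathrm{Peak}(\pi)=\{2\le i\le n-1\mid (i-1)\pi<i\pi>(i+1)\pi\}$. For $D\subseteq\{1,\ldots,n-1\}$ let $\Delta^D=\sum_{\mathrm{Des}(\pi)=D}\pi\in KS_n$ and $\Xi^D=\sum_{E\subseteq D}\Delta^E$; $\mathcal{D}_n$ is the span of the $\Delta^D$ and $\mathcal{D}=\bigoplus_{n\ge0}\mathcal{D}_n$. $\mathbb{N}^*$ is the free monoid over the set $\mathbb{N}$ of positive integers, with concatenation written $q.r$. For $q=q_1.\cdots.q_k\in\mathbb{N}^*$ with sum $n$ put $\Xi^q=\Xi^{D(q)}$, where $D(q)=\{q_1,q_1+q_2,\ldots,q_1+\cdots+q_{k-1}\}$. The Hopf algebra $(\mathcal{D},\star,\downarrow)$ is given by $\Xi^r\star\Xi^q=\Xi^{r.q}$ and the algebra homomorphism $\downarrow:\mathcal{D}\to\mathcal{D}\otimes\mathcal{D}$ with $\Xi^n\!\downarrow=\sum_{k=0}^n\Xi^k\otimes\Xi^{n-k}$, where $\Xi^0$ is the empty permutation in $S_0$, the identity of $(\mathcal{D},\star)$. $\mathcal{P}_n\subseteq\mathcal{D}_n$ is the span of the elements $\Pi^P=\sum_{\pi\in S_n,\ \mathrm{Peak}(\pi)=P}\pi$, $P\subseteq\{2,\ldots,n-1\}$. For $n\in\mathbb{N}$, $\tilde\Xi^n:=2\Pi^\emptyset\in\mathcal{P}_n$,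 and for $q=q_1.\cdots.q_k\in\mathbb{N}^*$, $\tilde\Xi^q:=\tilde\Xi^{q_1}\star\cdots\star\tilde\Xi^{q_k}$. A word $q=q_1.\cdots.q_k$ is odd if all $q_i$ are odd (the empty word is odd). *)

(* Defs.v *)
From HB Require Import structures.
From mathcomp Require Import all_boot all_order all_fingroup all_algebra.
From mathcomp Require Import finmap monalg zify.
From Stdlib Require Import ClassicalEpsilon.

Set Implicit Arguments.
Unset Strict Implicit.
Unset Printing Implicit Defensive.

Import GRing.Theory.
Local Open Scope ring_scope.

Section LinearCombinations.
Variables (K : fieldType) (V : lmodType K).

Definition lincomb (I : choiceType) (v : I -> V) (c : {malg K[I]}) : V :=
  \sum_(i <- msupp c) c@_i *: v i.

Definition lin_free (I : choiceType) (v : I -> V) : Prop :=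
  forall c : {malg K[I]}, lincomb v c = 0 -> c = 0.

Definition is_basis (I : choiceType) (v : I -> V) (A : V -> Prop) : Prop :=
  lin_free v /\ forall x, A x <-> exists c, x = lincomb v c.

(* For v linearly independent and x in its span: the coordinates of x; this is
   how linear maps are defined below by their values on a basis. *)
Definition coords (I : choiceType) (v : I -> V) (x : V) : {malg K[I]} :=
  epsilon (inhabits 0) (fun c => x = lincomb v c).

Definition is_subspace (A : V -> Prop) : Prop :=
  A 0 /\ forall a x y, A x -> A y -> A (a *: x + y).

Definition dsum (A : nat -> V -> Prop) (x : V) : Prop :=
  exists N (y : nat -> V), (forall n, A n (y n)) /\ x = \sum_(n < N) y n.

End LinearCombinations.

(* Positions and letters are numbered from 1, so that position i of s : 'S_n
   is the ordinal i.-1 of 'I_n. *)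
Definition img (n : nat) (s : 'S_n) (i : nat) : nat :=
  nth 0 [seq (val (s j)).+1 | j <- enum 'I_n] i.-1.

(* As 'I_n = {0, ..., n-1}, the subsets of {1, ..., n-1} are the sets in
   {set 'I_n} that do not contain 0. *)
Definition Des (n : nat) (s : 'S_n) : {set 'I_n} :=
  [set i : 'I_n | (0 < i)%N && (img s i.+1 < img s i)%N].

Definition Peak (n : nat) (s : 'S_n) : {set 'I_n} :=
  [set i : 'I_n | [&& 1 < i, img s i.-1 < img s i & img s i.+1 < img s i]%N].

Definition pos : Type := {n : nat | (0 < n)%N}.

Definition word : Type := seq pos.

Definition wsum (q : word) : nat := sumn (map val q).

Definition psums (q : word) : seq nat :=
  [seq sumn (take i (map val q)) | i <- iota 1 (size q).-1].

Definition Dset (q : word) : {set 'I_(wsum q)} := [set i | val i \in psums q].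

Definition odd_pos : Type := {i : pos | odd (val i)}.

Definition odd_word : Type := {q : word | all (fun i : pos => odd (val i)) q}.

Definition perms : Type := {n : nat & 'S_n}.

(* The direct sum of all K S_n. *)
Notation KS K := {malg K[perms]}.
(* KS (x) KS, with basis the pairs of permutations. *)
Notation KS2 K := {malg K[(perms * perms)%type]}.

Section Hopf.
Variable K : fieldType.
Local Notation KS := (KS K).
Local Notation KS2 := (KS2 K).

Definition eperm (n : nat) (s : 'S_n) : KS := << Tagged (fun n => 'S_n) s >>.

Definition KS1 : KS := eperm (1%g : 'S_0).

Definition Delta (n : nat) (D : {set 'I_n}) : KS :=
  \sum_(s : 'S_n | Des s == D) eperm s.

Definition Xi (n : nat) (D : {set 'I_n}) : KS :=
  \sum_(E : {set 'I_n} | E \subset D) Delta E.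

Definition descent_part (n : nat) (x : KS) : Prop :=
  exists c : {set 'I_n} -> K,
    x = \sum_(D : {set 'I_n} | D \subset [set i : 'I_n | (0 < i)%N]) c D *: Delta D.

Definition descent : KS -> Prop := dsum descent_part.

Definition Xin (n : nat) : KS := Xi (set0 : {set 'I_n}).

Definition Xiw (q : word) : KS := Xi (Dset q).

Definition tensor (x y : KS) : KS2 :=
  \sum_(a <- msupp x) \sum_(b <- msupp y) << x@_a * y@_b *g (a, b) >>.

Definition tensor_sub (A B : KS -> Prop) (t : KS2) : Prop :=
  exists s : seq (KS * KS),
    (forall p, p \in s -> A p.1 /\ B p.2) /\ t = \sum_(p <- s) tensor p.1 p.2.

Definition Xiw2 (p : word * word) : KS2 := tensor (Xiw p.1) (Xiw p.2).

(* The bilinear extension of Xi^q * Xi^r = Xi^(q.r). *)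
Definition star (x y : KS) : KS :=
  lincomb (fun q => lincomb (fun r => Xiw (q ++ r)) (coords Xiw y))
    (coords Xiw x).

(* (a (x) b) * (c (x) d) = (a * c) (x) (b * d). *)
Definition star2 (t u : KS2) : KS2 :=
  lincomb
    (fun p => lincomb
       (fun p' => tensor (star (Xiw p.1) (Xiw p'.1)) (star (Xiw p.2) (Xiw p'.2)))
       (coords Xiw2 u))
    (coords Xiw2 t).

Definition copn (n : nat) : KS2 :=
  \sum_(k < n.+1) tensor (Xin k) (Xin (n - k)).

(* Since Xi^q is the product of the Xi^(q_i), its image under the algebra
   homomorphism "down" is the product of the images of the Xi^(q_i). *)
Definition copw (q : word) : KS2 :=
  \big[star2/tensor KS1 KS1]_(i <- q) copn (val i).

Definition cop (x : KS) : KS2 := lincomb copw (coords Xiw x).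

(* The projection onto degree 0, i.e. the counit of cop. *)
Definition counit (x : KS) : K := x@_(Tagged (fun n => 'S_n) (1%g : 'S_0)).

(* The convolution product: apply f (x) g to x down, then multiply. *)
Definition conv (f g : KS -> KS) (x : KS) : KS :=
  lincomb (fun p => star (f (Xiw p.1)) (g (Xiw p.2))) (coords Xiw2 (cop x)).

Definition is_antipode (S : KS -> KS) : Prop :=
  [/\ forall x, descent x -> descent (S x),
      forall a x y, descent x -> descent y -> S (a *: x + y) = a *: S x + S y,
      forall x, descent x -> conv S id x = counit x *: KS1
    & forall x, descent x -> conv id S x = counit x *: KS1].

Definition is_hopf_subalgebra (A : KS -> Prop) : Prop :=
  [/\ is_subspace A /\ (forall x, A x -> descent x),
      A KS1,
      forall x y, A x -> A y -> A (star x y),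
      forall x, A x -> tensor_sub A A (cop x)
    & exists2 S, is_antipode S & forall x, A x -> A (S x)].

(* (A, star) is freely generated as an algebra with identity by the g i: the
   substitution of the g i for the variables is an isomorphism onto A from the
   algebra of polynomials in non-commuting variables (the monoid algebra of
   the free monoid). *)
Definition freely_generated (I : choiceType) (g : I -> KS) (A : KS -> Prop) :
    Prop :=
  exists phi : {linear {malg K[{fmonom I}]} -> KS},
    [/\ phi 1 = KS1,
        forall f h, phi (f * h) = star (phi f) (phi h),
        forall i, phi << fmu i >> = g i,
        injective phi
      & forall x, A x <-> exists f, x = phi f].

Definition Pi (n : nat) (P : {set 'I_n}) : KS :=
  \sum_(s : 'S_n | Peak s == P) eperm s.

Definition peak_part (n : nat) (x : KS) : Prop :=
  exists c : {set 'I_n} -> K,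
    x = \sum_(P : {set 'I_n} | P \subset [set i : 'I_n | (1 < i)%N]) c P *: Pi P.

Definition peak : KS -> Prop := dsum peak_part.

(* In degree 0 this is the empty permutation, not twice it. *)
Definition tXin (n : nat) : KS :=
  if n == 0%N then KS1 else 2 *: Pi (set0 : {set 'I_n}).

Definition tXiw (q : word) : KS := \big[star/KS1]_(i <- q) tXin (val i).

End Hopf.

(* The Xi^q form a basis of the descent algebra and the Xi^q (x) Xi^r are
   linearly independent, so star, star2 and cop have the intended values. *)
Section Facts.
Variable K : fieldType.

Lemma seq_argmax (I : eqType) (rk : I -> nat) (s : seq I) : s != [::] ->
  exists2 i, i \in s & forall j, j \in s -> (rk j <= rk i)%N.
Proof.
elim: s => // a s IH _; have [->|/IH[i is_ H]] := eqVneq s [::].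
  by exists a; rewrite ?inE // => j; rewrite inE => /eqP->.
case: (leqP (rk a) (rk i)) => h.
  by exists i; rewrite ?inE ?is_ ?orbT // => j; rewrite inE => /orP[/eqP->|/H].
exists a; rewrite ?inE ?eqxx // => j; rewrite inE => /orP[/eqP->//|/H].
by move/leq_trans; apply; apply: ltnW.
Qed.

Lemma triangular_free (I X : choiceType) (v : I -> {malg K[X]}) (pt : I -> X)
    (rk : I -> nat) :
  (forall i, (v i)@_(pt i) != 0) ->
  (forall i j, (v j)@_(pt i) != 0 -> j = i \/ (rk i < rk j)%N) ->
  lin_free v.
Proof.
move=> v1 v2 c c0; apply/malgP => k; rewrite mcoeff0; apply/eqP.
rewrite mcoeff_eq0; apply/negP => kc.
have [|i ic Hi] := @seq_argmax _ rk (msupp c : seq I).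
  by apply/eqP => E; have : k \in (msupp c : seq I) by []; rewrite E.
have := congr1 (mcoeff (pt i)) c0; rewrite /lincomb raddf_sum mcoeff0 /=.
rewrite (bigD1_seq i) ?fset_uniq //= big_seq_cond big1 => [|j /andP[jc ji]].
  by rewrite addr0 mcoeffZ => /eqP; rewrite mulf_eq0 (negPf (v1 i)) mcoeff_eq0 ic.
rewrite mcoeffZ; case: (eqVneq (v j)@_(pt i) 0) => [->|/v2[/eqP|]].
- by rewrite mulr0.
- by rewrite (negPf ji).
- by rewrite ltnNge Hi.
Qed.

Notation T s := (Tagged (fun n => 'S_n) s).

Lemma eperm_coef n (s t : 'S_n) : (eperm K s)@_(T t) = (s == t)%:R.
Proof. by rewrite /eperm mcoeffU eq_Tagged. Qed.

Lemma Delta_coef n (E : {set 'I_n}) (s : 'S_n) : (Delta K E)@_(T s) = (Des s == E)%:R.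
Proof.
rewrite /Delta raddf_sum /= (eq_bigr (fun t => if t == s then 1 else 0)); last first.
  by move=> t _; rewrite eperm_coef; case: eqP.
rewrite -big_mkcondr /=; case: eqP => h.
  by rewrite (big_pred1 s) // => t /=; case: (t =P s) => [->|]; rewrite ?andbF ?h ?eqxx.
by rewrite big_pred0 // => t /=; case: (t =P s) => [->|]; rewrite ?andbF // andbT; apply/eqP.
Qed.

Lemma Xi_coef n (D : {set 'I_n}) (s : 'S_n) :
  (Xi K D)@_(T s) = (Des s \subset D)%:R.
Proof.
rewrite /Xi raddf_sum /= (eq_bigr (fun t => if t == Des s then 1 else 0)); last first.
  by move=> t _; rewrite Delta_coef eq_sym; case: eqP.
rewrite -big_mkcondr /=; case: (boolP (Des s \subset D)) => h.
  by rewrite (big_pred1 (Des s)) // => t /=; case: (t =P _) => [->|]; rewrite ?andbF // h.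
by rewrite big_pred0 // => t /=; case: (t =P _) => [->|]; rewrite ?andbF // (negPf h).
Qed.

Lemma Xi_coef0 n n' (D : {set 'I_n}) (s : 'S_n') : n != n' -> (Xi K D)@_(T s) = 0.
Proof.
move=> nn; rewrite /Xi raddf_sum /= big1 // => E _.
rewrite /Delta raddf_sum /= big1 // => t _.
by rewrite /eperm mcoeffU -[_ == _ :> perms]/((n == n') && _) (negPf nn).
Qed.

Lemma imgE n (s : 'S_n) (i : 'I_n) : img s i.+1 = (s i).+1.
Proof.
rewrite /img /= (nth_map i) ?size_enum_ord //; congr (_.+1).
by rewrite nth_ord_enum.
Qed.

Lemma ex_Des n (D : {set 'I_n}) : (forall i, i \in D -> (0 < i)%N) ->
  exists s : 'S_n, Des s = D.
Proof.
move=> Dpos.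
pose b (i : nat) := #|[set d in D | (d <= i)%N]|.
have bn i : (b i <= n)%N by rewrite (leq_trans (max_card _)) ?card_ord.
pose key (i : 'I_n) := ((n - b i) * n + i)%N.
have key_inj : injective key.
  move=> i j /(congr1 (modn^~ n)); rewrite !modnMDl !modn_small //.
  by move/val_inj.
pose rk (i : 'I_n) := #|[set j | (key j < key i)%N]|.
have rk_lt i : (rk i < n)%N.
  rewrite -[X in (_ < X)%N]card_ord -cardsT; apply: proper_card.
  by rewrite properE subsetT; apply/subsetPn; exists i; rewrite ?inE ?ltnn.
have rk_mono i j : (key i < key j)%N -> (rk i < rk j)%N.
  move=> ij; apply: proper_card; rewrite properE; apply/andP; split.
    by apply/subsetP => k; rewrite !inE => /ltn_trans; apply.
  by apply/subsetPn; exists i; rewrite !inE ?ltnn.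
have rkE i j : (rk i < rk j)%N = (key i < key j)%N.
  apply/idP/idP => [|/rk_mono//]; case: (ltngtP (key i) (key j)) => [|ji|/key_inj->] //; last by rewrite ltnn.
  by rewrite ltnNge (ltnW (rk_mono _ _ ji)).
have rk_inj : injective (fun i => Ordinal (rk_lt i)).
  move=> i j /(congr1 val) /= E; apply: key_inj.
  by case: (ltngtP (key i) (key j)) => // /rk_mono; rewrite E ltnn.
exists (perm rk_inj); apply/setP => i; rewrite !inE.
case: (posnP i) => [i0|ip] /=.
  by apply/esym/negP => /Dpos; rewrite i0.
have il : (i.-1 < n)%N by case: (i) ip => -[] //= m mn _; apply: ltnW.
have -> : img (perm rk_inj) i = (perm rk_inj (Ordinal il)).+1.
  by rewrite -(imgE _ (Ordinal il)) /= prednK.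
rewrite imgE !permE ltnS /= rkE /key /=.
have bS : b i = (b i.-1 + (i \in D))%N.
  rewrite /b (cardsD1 i) !inE leqnn andbT addnC; congr (_ + _)%N.
  apply: eq_card => d; rewrite !inE; case: (d \in D); rewrite ?andbF //=.
  by rewrite -val_eqE /=; lia.
have := bn i; rewrite bS; case: (i \in D) => /= h; last by nia.
have -> : (n - b i.-1 = (n - (b i.-1 + 1)).+1)%N by lia.
by rewrite mulSn; move: (ltn_ord i); lia.
Qed.

Lemma psums_pos (q : word) x : x \in psums q -> (0 < x < wsum q)%N.
Proof.
case/mapP => i; rewrite mem_iota => /andP[i1 iq] ->.
rewrite /wsum -[X in (_ && (_ < sumn X)%N)](cat_take_drop i) sumn_cat.
have pp (s : word) : s != [::] -> (0 < sumn (map val s))%N.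
  by case: s => //= -[a a0] s _ /=; rewrite addn_gt0 a0.
rewrite -map_take -map_drop pp /=; last first.
  by move: iq i1; rewrite add1n; case: (q) => // [|? ?]; case: (i).
rewrite -[X in (X < _)%N]addn0 ltn_add2l pp //.
rewrite -size_eq0 size_drop subn_eq0 -ltnNge.
by move: iq i1; rewrite add1n; case: (size q) => //; case: (i).
Qed.

Lemma psums_cons a (q : word) : psums (a :: q) =
  if q is [::] then [::] else val a :: map (addn (val a)) (psums q).
Proof.
case: q => //= b q; rewrite /psums /= addn0; congr (_ :: _).
by rewrite -map_comp (iotaDl 1 1) -map_comp.
Qed.

Lemma psums_inj (q r : word) : wsum q = wsum r -> psums q = psums r -> q = r.
Proof.
have pz (u : word) : wsum u = 0%N -> u = [::] by case: u => // -[[|a] a0] u.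
elim: q r => [|a q' IH] [|b r'].
- by [].
- by move/esym/pz.
- by move/pz.
- rewrite !psums_cons /wsum /=.
  case: q' IH => [|a' q'] IH; case: r' => [|b' r'] //=.
    by rewrite !addn0 => /val_inj->.
  move=> H [] ab psE; have {}ab : a = b by apply: val_inj.
  subst b; congr (_ :: _); apply: IH; first by move/addnI: H.
  by apply: inj_map psE => x y /addnI.
Qed.

Lemma psums_sorted (q : word) : sorted ltn (psums q).
Proof.
elim: q => // a q IH; rewrite psums_cons; case: q IH => // b q IH.
rewrite /= path_sortedE; last exact: ltn_trans.
rewrite all_map; apply/andP; split.
  apply/allP => x /psums_pos /andP[x0 _] /=; by rewrite -[X in (X < _)%N]addn0 ltn_add2l.
by rewrite sorted_map (@eq_sorted _ _ ltn) // => x y /=; rewrite ltn_add2l.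
Qed.

Lemma Xiw_pt (q : word) : exists s : 'S_(wsum q), Des s = Dset q.
Proof.
by apply: ex_Des => i; rewrite inE => /psums_pos /andP[].
Qed.

Definition wpt (q : word) : perms := T (projT1 (constructive_indefinite_description _ (Xiw_pt q))).

Lemma Xiw_wpt q : (Xiw K q)@_(wpt q) = 1.
Proof.
by rewrite /wpt; case: constructive_indefinite_description => s /= E; rewrite Xi_coef E subxx.
Qed.

Lemma Xiw_wpt_lt q r : (Xiw K r)@_(wpt q) != 0 -> r = q \/ (size q < size r)%N.
Proof.
rewrite /wpt; case: constructive_indefinite_description => s /= E.
have [wE|] := eqVneq (wsum r) (wsum q); last by move/Xi_coef0 ->; rewrite eqxx.
have sub : (Xiw K r)@_(T s) != 0 -> {subset psums q <= psums r}.
  have HD i : (i \in Dset r) = (val i \in psums r) by rewrite inE.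
  move: s E; rewrite /Xiw; move: (Dset r) HD.
  rewrite wE => D HD s E; rewrite Xi_coef E.
  case: (boolP (_ \subset _)) => [/subsetP sD _ x xq|]; last by rewrite eqxx.
  have /andP[_ xlt] := psums_pos xq.
  by have := sD (Ordinal xlt); rewrite !inE /= xq HD => /(_ isT).
move=> /sub {}sub; case: (ltnP (size q) (size r)) => [|rq]; [by right|left].
apply: psums_inj => //; apply: irr_sorted_eq (psums_sorted _) (psums_sorted _) _.
- exact: ltn_trans.
- exact: ltnn.
have uq : uniq (psums q) by apply: sorted_uniq (psums_sorted _); [exact: ltn_trans|exact: ltnn].
have [|_ H] := uniq_min_size uq sub; last by move=> x; rewrite H.
by rewrite !size_map !size_iota; move: rq; lia.
Qed.

Lemma Xiw_free : lin_free (Xiw K).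
Proof.
apply: (@triangular_free _ _ _ wpt size) => [q|]; last exact: Xiw_wpt_lt.
by rewrite Xiw_wpt oner_eq0.
Qed.

Lemma tensor_coef (x y : KS K) a b : (tensor x y)@_(a, b) = x@_a * y@_b.
Proof.
rewrite /tensor raddf_sum /=.
transitivity (\sum_(i <- msupp x) (if i == a then x@_i else 0) * y@_b).
  apply: eq_bigr => i _; rewrite raddf_sum /=.
  transitivity (\sum_(j <- msupp y) (if i == a then x@_i else 0) * (if j == b then y@_j else 0)).
    apply: eq_bigr => j _; rewrite mcoeffU xpair_eqE.
    by case: eqP; case: eqP; rewrite ?mulr1n ?mulr0n ?mul0r ?mulr0.
  rewrite -mulr_sumr; congr (_ * _); rewrite -big_mkcond /=.
  case: (boolP (b \in msupp y)) => by_; first by rewrite -big_filter filter_pred1_uniq ?fset_uniq // big_seq1.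
  rewrite big_seq_cond big_pred0 ?mcoeff_outdom // => j.
  by case: eqP => [->|]; rewrite ?andbF // (negPf by_).
rewrite -mulr_suml; congr (_ * _); rewrite -big_mkcond /=.
case: (boolP (a \in msupp x)) => by_; first by rewrite -big_filter filter_pred1_uniq ?fset_uniq // big_seq1.
rewrite big_seq_cond big_pred0 ?mcoeff_outdom // => j.
by case: eqP => [->|]; rewrite ?andbF // (negPf by_).
Qed.

Lemma Xiw2_free : lin_free (Xiw2 K).
Proof.
apply: (@triangular_free _ _ _ (fun p => (wpt p.1, wpt p.2)) (fun p => size p.1 + size p.2)%N).
  by move=> [q r]; rewrite tensor_coef !Xiw_wpt mulr1 oner_eq0.
move=> [q r] [q' r']; rewrite tensor_coef mulf_eq0 negb_or /= => /andP[].
by move=> /Xiw_wpt_lt[->|h] /Xiw_wpt_lt[->|h']; [left|right; rewrite ltn_add2l|right; rewrite ltn_add2r|right; rewrite -addSn leq_add // ltnW].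
Qed.

Lemma lincombE (V : lmodType K) (I : choiceType) (v : I -> V) (c : {malg K[I]}) (d : {fset I}) :
  (msupp c `<=` d)%fset -> lincomb v c = \sum_(i <- d) c@_i *: v i.
Proof.
move=> cd; rewrite /lincomb (big_fset_incl _ cd) //= => i _ ic.
by rewrite mcoeff_outdom ?scale0r.
Qed.

Lemma lincomb_lin (V : lmodType K) (I : choiceType) (v : I -> V) a (c d : {malg K[I]}) :
  lincomb v (a *: c + d) = a *: lincomb v c + lincomb v d.
Proof.
pose D := (msupp (a *: c + d) `|` msupp c `|` msupp d)%fset.
rewrite !(@lincombE _ _ _ _ D); first last.
- by apply/fsubsetP => x; rewrite !inE => ->.
- by apply/fsubsetP => x; rewrite !inE => ->; rewrite ?orbT.
- by apply/fsubsetP => x; rewrite !inE => ->; rewrite ?orbT.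
rewrite scaler_sumr -big_split; apply: eq_bigr => i _ /=.
by rewrite mcoeffD mcoeffZ scalerDl scalerA.
Qed.

Lemma lincombU (V : lmodType K) (I : choiceType) (v : I -> V) i : lincomb v << i >> = v i.
Proof. by rewrite /lincomb msuppU oner_eq0 big_seq_fset1 mcoeffUU scale1r. Qed.

Lemma coordsK (V : lmodType K) (I : choiceType) (v : I -> V) : lin_free v ->
  forall c, coords v (lincomb v c) = c.
Proof.
move=> fv c; rewrite /coords.
have /esym E := epsilon_spec (inhabits (0 : {malg K[I]})) (fun c' => lincomb v c = lincomb v c') (ex_intro _ c erefl).
apply/eqP; rewrite -subr_eq0 addrC -scaleN1r; apply/eqP/fv.
move: E; set e := epsilon _ _ => E.
rewrite [- 1 *: c + e]addrC addrC.
by rewrite lincomb_lin E scaleN1r addNr.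
Qed.

Lemma coords_basis (V : lmodType K) (I : choiceType) (v : I -> V) : lin_free v ->
  forall i, coords v (v i) = << i >>.
Proof. by move=> fv i; rewrite -(lincombU v i) coordsK. Qed.

Lemma star_Xiw q r : star (Xiw K r) (Xiw K q) = Xiw K (r ++ q).
Proof. by rewrite /star !(coords_basis Xiw_free) !lincombU. Qed.

Lemma star2_Xiw2 p p' : star2 (Xiw2 K p) (Xiw2 K p') =
  tensor (star (Xiw K p.1) (Xiw K p'.1)) (star (Xiw K p.2) (Xiw K p'.2)).
Proof. by rewrite /star2 !(coords_basis Xiw2_free) !lincombU. Qed.

Lemma cop_Xiw q : cop (Xiw K q) = copw K q.
Proof. by rewrite /cop (coords_basis Xiw_free) lincombU. Qed.

Lemma Xiw_nil : Xiw K [::] = KS1 K.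
Proof.
apply/malgP => -[[|n] s]; last by rewrite Xi_coef0 // /KS1 /eperm mcoeffU.
rewrite eperm_coef Xi_coef (_ : Des s = set0); last by apply/setP => -[].
by rewrite sub0set (_ : s = 1%g) ?eqxx //; apply/permP => -[].
Qed.

Lemma Xiw1 (n : pos) : Xiw K [:: n] = Xin K (val n).
Proof.
rewrite /Xiw /Xin (_ : Dset _ = set0); last by apply/setP => i; rewrite !inE.
by rewrite /wsum /= addn0.
Qed.

Lemma ex_word (l : seq nat) (m n : nat) : path ltn m (rcons l n) ->
  exists q, wsum q = (n - m)%N /\ psums q = map (subn^~ m) l.
Proof.
elim: l m => [|a l IH] m /=.
  rewrite andbT -subn_gt0 => mn; exists [:: exist _ (n - m)%N mn].
  by rewrite /wsum /= addn0.
move=> /andP[ma /[dup] /IH[q [qs qp]] al].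
have an : (a < n)%N.
  by have /allP := order_path_min ltn_trans al; apply; rewrite mem_rcons inE eqxx.
have ma' : (0 < a - m)%N by rewrite subn_gt0.
exists (exist _ (a - m)%N ma' :: q); rewrite psums_cons /wsum /= -/(wsum q) qs.
split; first by rewrite addnC addnBA ?subnK // ltnW.
case: q qs qp => [|b q] qs qp.
  by move: an; rewrite -subn_gt0 -qs.
rewrite qp -map_comp; congr (_ :: _); apply/eq_in_map => x xl /=.
have ax : (a < x)%N.
  by have /allP := order_path_min ltn_trans al; apply; rewrite mem_rcons inE xl orbT.
by lia.
Qed.

Lemma ex_Dset n (D : {set 'I_n}) : D \subset [set i : 'I_n | (0 < i)%N] ->
  exists q, Xiw K q = Xi K D.
Proof.
move=> /subsetP Dp.
have [n0|np] := posnP n.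
  by exists [::]; subst n; congr Xi; apply/setP => -[].
pose l := [seq val i | i <- enum D].
have lD x : (x \in l) = [exists i in D, val i == x].
  apply/mapP/exists_inP => -[i iD] => [->|/eqP<-].
    by exists i; rewrite // -mem_enum.
  by exists i; rewrite ?mem_enum.
have ls : sorted ltn l.
  apply: (subseq_sorted ltn_trans _ (iota_ltn_sorted 0 n)).
  by rewrite -val_enum_ord map_subseq // enumT filter_subseq.
have lp : path ltn 0 (rcons l n).
  rewrite rcons_path path_sortedE ?ls ?andbT; last exact: ltn_trans.
  apply/andP; split.
    by apply/allP => x; rewrite lD => /exists_inP[i /Dp]; rewrite inE => ? /eqP<-.
  have := mem_last 0%N l; rewrite inE lD => /orP[/eqP-> //|/exists_inP[i _ /eqP<-]].
  exact: ltn_ord.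
have [q [qs qp]] := ex_word lp; exists q.
have {}qp : psums q = l by rewrite qp (eq_map subn0) map_id.
rewrite subn0 in qs; subst n; congr Xi; apply/setP => i.
rewrite inE qp lD; apply/exists_inP/idP => [[j jD /eqP/val_inj<-]//|iD].
by exists i.
Qed.

Lemma Xiw_basis : is_basis (Xiw K) (@descent K).
Proof.
split=> [|x]; first exact: Xiw_free.
pose sp (y : KS K) := exists c, y = lincomb (Xiw K) c.
have spl a y z : sp y -> sp z -> sp (a *: y + z).
  by move=> [c ->] [d ->]; exists (a *: c + d); rewrite lincomb_lin.
have sp0 : sp 0 by exists 0; rewrite /lincomb msupp0 big_seq_fset0.
have spD y z : sp y -> sp z -> sp (y + z) by move=> *; rewrite -[y]scale1r; apply: spl.
have spZ a y : sp y -> sp (a *: y) by move=> *; rewrite -[_ *: _]addr0; apply: spl.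
have spDelta n (D : {set 'I_n}) : D \subset [set i : 'I_n | (0 < i)%N] -> sp (Delta K D).
  have [m] := ubnP #|D|; elim: m D => // m IH D; rewrite ltnS => Dm Dp.
  have [q qE] := ex_Dset Dp.
  have -> : Delta K D = (-1) *: (\sum_(E : {set 'I_n} | E \proper D) Delta K E) + Xi K D.
    have -> : Xi K D = Delta K D + \sum_(E : {set 'I_n} | E \proper D) Delta K E.
      rewrite [LHS](bigD1 D) //=; congr (_ + _).
      by apply: eq_bigl => E; rewrite properEneq andbC.
    by rewrite scaleN1r addrCA addNr addr0.
  apply: spl; last by rewrite -qE; exists << q >>; rewrite lincombU.
  apply: (big_ind sp) => // E EP; apply: IH.
    exact: leq_trans (proper_card EP) _.
  exact: subset_trans (proper_sub EP) Dp.
split=> [[N [y [yD ->]]]|[c ->]].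
  apply: (big_ind sp) => // i _; have [c ->] := yD i.
  by apply: (big_ind sp) => // D /spDelta; apply: spZ.
pose N := (\max_(q <- msupp c) wsum q).+1.
exists N, (fun n => \sum_(q <- msupp c | wsum q == n) c@_q *: Xiw K q); split=> [n|].
  pose P (x : KS K) := descent_part n x.
  apply: (big_ind P) => [|y z [d ->] [e ->]|q /eqP nE]; rewrite /P -?nE.
  - by exists (fun=> 0); rewrite big1 // => *; rewrite scale0r.
  - exists (fun D => d D + e D); rewrite -big_split /=.
    by apply: eq_bigr => *; rewrite scalerDl.
  exists (fun D : {set 'I_(wsum q)} => if D \subset Dset q then c@_q else 0).
  rewrite /Xiw /Xi scaler_sumr [RHS](bigID (fun D : {set 'I_(wsum q)} => D \subset Dset q)) /=.
  rewrite [X in _ = _ + X]big1 ?addr0; last by move=> D /andP[_ /negPf->]; rewrite scale0r.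
  rewrite [LHS](eq_bigl (fun D : {set 'I_(wsum q)} => (D \subset [set i : 'I_(wsum q) | (0 < i)%N]) && (D \subset Dset q))).
    by apply: eq_bigr => D /andP[_ ->].
  move=> D; case: (boolP (D \subset Dset q)); rewrite ?andbF // andbT => DE.
  apply/esym/(subset_trans DE)/subsetP => i; rewrite !inE.
  by move/psums_pos/andP => [].
rewrite /lincomb.
under [RHS]eq_bigr do rewrite big_mkcond.
rewrite exchange_big /= big_seq [RHS]big_seq; apply: eq_bigr => q qc.
have qN : (wsum q < N)%N by rewrite ltnS leq_bigmax_seq.
by rewrite -big_mkcond (big_pred1 (Ordinal qN)).
Qed.

End Facts.

(* Main.v *)
(* Let H(t) = sum_n Xi^n t^n, a power series over the free algebra (D, star), and
   T(t) = H(-t)^-1 H(t). At a permutation whose descent set is D, the coefficient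
   of t^n in H(-t)^-1 is 1 or 0 according to whether D is full or not, so that
   of T(t) is 2 if there is no peak and 0 otherwise: T(t) = sum_n tXi^n t^n.
   - As H(t) is group-like, cancelling in H(-t) T(t) = H(t) shows that T(t) is
     group-like too, and that the antipode maps T(t) to T(-t).
   - T(t) T(-t) = 1 expresses tXi^n for n even by the tXi^i with i < n.
   - For n odd, tXi^n is 2 Xi^n plus longer products, so the tXi^q with q odd are
     linearly independent.
   - tXi^q is 2^(length of q) times the sum of the Pi^P over the sets P contained
     in the union of the {s, s+1}, s running over the partial sums of q. Hence
     tXi^q is in the peak space; and given P, the word q with partial sums P
     yields Pi^P modulo sets of smaller weight, because a peak set contains no
     two consecutive numbers. So the tXi^q span the peak space. *)

From HB Require Import structures.
Require Import Defs.
From mathcomp Require Import all_boot all_order all_fingroup all_algebra.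
From mathcomp Require Import finmap monalg zify.
From Stdlib Require Import FunctionalExtensionality.

Set Implicit Arguments.
Unset Strict Implicit.
Unset Printing Implicit Defensive.

Import GRing.Theory.
Local Open Scope ring_scope.

(** * Linear combinations and monoid algebras *)

Section Lincomb.
Variable K : fieldType.

Fact lincomb_is_linear (V : lmodType K) (I : choiceType) (v : I -> V) :
  linear (lincomb v).
Proof. by move=> a x y; rewrite lincomb_lin. Qed.

HB.instance Definition _ (V : lmodType K) (I : choiceType) (v : I -> V) :=
  GRing.isLinear.Build K {malg K[I]} V *:%R (lincomb v) (lincomb_is_linear v).

Lemma malg_lin_ind (I : choiceType) (P : {malg K[I]} -> Prop) :
  P 0 -> (forall i, P << i >>) ->
  (forall a x y, P x -> P y -> P (a *: x + y)) -> forall x, P x.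
Proof.
move=> P0 PU PD x; rewrite (monalgE x); apply: (big_ind P) => //.
  by move=> y z Py Pz; rewrite -[y]scale1r; apply: PD.
move=> i _; rewrite -[<<_ *g _>>]addr0.
suff -> : << x@_i *g i >> = x@_i *: << i >> by apply: PD.
by apply/malgP => j; rewrite mcoeffZ !mcoeffU mulrnAr mulr1.
Qed.

Lemma linear_add (V W : lmodType K) (h : V -> W) : linear h -> {morph h : x y / x + y}.
Proof. by move=> hl x y; rewrite -[x]scale1r hl !scale1r. Qed.

Lemma linear_zero (V W : lmodType K) (h : V -> W) : linear h -> h 0 = 0.
Proof. by move=> hl; have := hl (-1) 0 0; rewrite scaler0 addr0 scaleN1r addNr. Qed.

Lemma linear_scale (V U : lmodType K) (h : V -> U) : linear h -> forall a x, h (a *: x) = a *: h x.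
Proof. by move=> hl a x; rewrite -[a *: x]addr0 hl (linear_zero hl) addr0. Qed.

Lemma eq_linear_malg (I : choiceType) (V : lmodType K) (f g : {malg K[I]} -> V) :
  linear f -> linear g -> (forall i, f << i >> = g << i >>) -> f =1 g.
Proof.
move=> fl gl fg; apply: malg_lin_ind => //; last first.
  by move=> a x y fx fy; rewrite fl gl fx fy.
by rewrite (linear_zero fl) (linear_zero gl).
Qed.

Lemma lincomb_lincomb (I J : choiceType) (V : lmodType K) (v : J -> V)
    (u : I -> {malg K[J]}) c :
  lincomb v (lincomb u c) = lincomb (fun i => lincomb v (u i)) c.
Proof.
move: c; apply: eq_linear_malg => [a x y|a x y|i]; rewrite ?linearP //.
by rewrite !lincombU.
Qed.

Lemma eq_lincomb (I : choiceType) (V : lmodType K) (u v : I -> V) c :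
  u =1 v -> lincomb u c = lincomb v c.
Proof. by move=> uv; apply: eq_bigr => i _; rewrite uv. Qed.

Lemma lincomb_id (I : choiceType) (c : {malg K[I]}) : lincomb (fun i => << i >>) c = c.
Proof.
move: c; apply: (@eq_linear_malg I _ _ id) => [a x y|a x y|i] //.
  by rewrite linearP.
by rewrite lincombU.
Qed.

Lemma lincomb_additive (I : choiceType) (V : lmodType K) (u v : I -> V) a c :
  lincomb (fun i => a *: u i + v i) c = a *: lincomb u c + lincomb v c.
Proof.
rewrite /lincomb scaler_sumr -big_split /=; apply: eq_bigr => i _.
by rewrite scalerDr !scalerA mulrC.
Qed.

Lemma lincomb_apply (I : choiceType) (V W : lmodType K) (f : V -> W) (v : I -> V) c :
  linear f -> f (lincomb v c) = lincomb (fun i => f (v i)) c.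
Proof.
move=> fl; move: c; apply: eq_linear_malg => [a x y|a x y|i].
- by rewrite linearP fl.
- by rewrite linearP.
- by rewrite !lincombU.
Qed.

Lemma subspace_lincomb (I : choiceType) (V : lmodType K) (A : V -> Prop) (v : I -> V) c :
  is_subspace A -> (forall i, A (v i)) -> A (lincomb v c).
Proof.
move=> [A0 Al] Av; apply: (big_ind A) => // [x y Ax Ay|i _].
  by rewrite -[x]scale1r; apply: Al.
by rewrite -[_ *: _]addr0; apply: Al.
Qed.

Section Subspace.
Variables (V : lmodType K) (A : V -> Prop).
Hypothesis As : is_subspace A.

Lemma subspaceD x y : A x -> A y -> A (x + y).
Proof. by move=> Ax Ay; rewrite -[x]scale1r; apply: As.2. Qed.

Lemma subspaceZ a x : A x -> A (a *: x).
Proof. by move=> Ax; rewrite -[_ *: _]addr0; apply: As.2 => //; apply: As.1. Qed.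

Lemma subspaceN x : A x -> A (- x).
Proof. by rewrite -scaleN1r; apply: subspaceZ. Qed.

Lemma subspace_sum I (r : seq I) (P : pred I) (F : I -> V) :
  (forall i, P i -> A (F i)) -> A (\sum_(i <- r | P i) F i).
Proof. by move=> AF; apply: (big_ind A) => //; [apply: As.1 | apply: subspaceD]. Qed.

End Subspace.

Lemma dsum_subspace (V : lmodType K) (A : nat -> V -> Prop) :
  (forall n, is_subspace (A n)) -> is_subspace (dsum A).
Proof.
move=> As; split.
  by exists 0%N, (fun=> 0); split=> [n|]; [apply: (As n).1 | rewrite big_ord0].
move=> a x y [N [u [Au ->]]] [M [v [Av ->]]].
have A0 n := (As n).1.
exists (N + M)%N, (fun n => a *: (if (n < N)%N then u n else 0) + if (n < M)%N then v n else 0).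
split=> [n|]; first by apply: (As n).2; case: ifP.
rewrite big_split -scaler_sumr /= -!big_mkcond /=; congr (_ *: _ + _).
  by rewrite (big_ord_widen _ _ (leq_addr M N)).
by rewrite (big_ord_widen _ _ (leq_addl N M)).
Qed.

End Lincomb.

Section MonoidAlgebra.
Variable K : fieldType.

Lemma malg_scalerAr (M : monomType) a (x y : {malg K[M]}) : a *: (x * y) = x * (a *: y).
Proof.
rewrite -!mul_malgC !mulrA; congr (_ * y).
rewrite mul_malgC; apply/malgP => k; rewrite mcoeffZ.
rewrite (mcoeffMr _ (a%:MP)) msuppC.
have [->|a0] := eqVneq a 0.
  by rewrite big_seq_fset0 mul0r.
rewrite big_seq_fset1 {1}(monalgE x) raddf_sum /= mulr_sumr; apply: eq_bigr => i _.
by rewrite mulm1 mcoeffUU mcoeffU eq_sym mulrnAr mulrC.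
Qed.

Lemma malgU_mul (M : monomType) (m m' : M) : << mmul m m' >> = << m >> * << m' >> :> {malg K[M]}.
Proof. by rewrite malgM_def fgmulUU mulr1. Qed.

Lemma malg_linear_mull (M : monomType) (x : {malg K[M]}) : linear (fun y => x * y).
Proof. by move=> a y z; rewrite mulrDr malg_scalerAr. Qed.

Lemma malg_linear_mulr (M : monomType) (x : {malg K[M]}) : linear (fun y => y * x).
Proof. by move=> a y z; rewrite mulrDl scalerAl. Qed.

Section UniversalProperty.
Variables (I : choiceType) (M : monomType) (g : I -> {malg K[M]}).

Definition malg_ext : {malg K[{fmonom I}]} -> {malg K[M]} :=
  lincomb (fun m : {fmonom I} => \prod_(i <- (m : seq I)) g i).

HB.instance Definition _ := GRing.Linear.copy malg_ext
  (lincomb (fun m : {fmonom I} => \prod_(i <- (m : seq I)) g i)).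

Lemma malg_extE (m : {fmonom I}) : malg_ext << m >> = \prod_(i <- (m : seq I)) g i.
Proof. by rewrite /malg_ext lincombU. Qed.

Lemma malg_extU i : malg_ext << fmu i >> = g i.
Proof. by rewrite malg_extE fmU big_seq1. Qed.

Lemma malg_ext1 : malg_ext 1 = 1.
Proof. by rewrite malg_extE fm1 big_nil. Qed.

Lemma malg_extM : {morph malg_ext : x y / x * y}.
Proof.
move=> x y; move: x; apply: eq_linear_malg => [a x z|a x z|m].
- by rewrite mulrDl -scalerAl linearP.
- by rewrite linearP mulrDl -scalerAl.
move: y; apply: eq_linear_malg => [a x z|a x z|m'].
- by rewrite malg_linear_mull linearP.
- by rewrite linearP malg_linear_mull.
by rewrite -malgU_mul !malg_extE fmM big_cat.
Qed.

End UniversalProperty.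

Section ProductMonoid.
Variables M N : monomType.

Definition pair_mone : M * N := (mone, mone).
Definition pair_mmul (x y : M * N) : M * N := (mmul x.1 y.1, mmul x.2 y.2).

Fact pair_mmulA : associative pair_mmul.
Proof. by move=> x y z; rewrite /pair_mmul !mulmA. Qed.
Fact pair_mmul1m : left_id pair_mone pair_mmul.
Proof. by case=> x y; rewrite /pair_mmul !mul1m. Qed.
Fact pair_mmulm1 : right_id pair_mone pair_mmul.
Proof. by case=> x y; rewrite /pair_mmul !mulm1. Qed.
Fact pair_munit x y : pair_mmul x y = pair_mone -> x = pair_mone /\ y = pair_mone.
Proof. by case: x y => [x x'] [y y'] [/unitm[-> ->] /unitm[-> ->]]. Qed.

HB.instance Definition _ := Choice_isMonomialDef.Build (M * N)%type
  pair_mmulA pair_mmul1m pair_mmulm1 pair_munit.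

Lemma pair_mmulE (x y : M * N) : mmul x y = (mmul x.1 y.1, mmul x.2 y.2).
Proof. by []. Qed.

Definition tens (x : {malg K[M]}) (y : {malg K[N]}) : {malg K[(M * N)%type]} :=
  lincomb (fun m => lincomb (fun n => << (m, n) >>) y) x.

Lemma tens_linearl y : linear (tens^~ y).
Proof. by move=> a x z; rewrite /tens linearP. Qed.

Lemma tens_linearr x : linear (tens x).
Proof.
by move=> a y z; rewrite /tens -lincomb_additive; apply: eq_lincomb => m; rewrite linearP.
Qed.

Lemma tensU m n : tens << m >> << n >> = << (m, n) >>.
Proof. by rewrite /tens !lincombU. Qed.

Lemma tens1 : tens 1 1 = 1.
Proof. by rewrite tensU. Qed.

Lemma tensM x y x' y' : tens (x * x') (y * y') = tens x y * tens x' y'.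
Proof.
have tl := tens_linearl; have tr := tens_linearr.
have ml := @malg_linear_mull; have mr := @malg_linear_mulr.
move: x; apply: eq_linear_malg => [a ? ?|a ? ?|m]; rewrite ?mr ?tl ?mr //.
move: x'; apply: eq_linear_malg => [a ? ?|a ? ?|m']; rewrite ?ml ?tl ?ml //.
move: y; apply: eq_linear_malg => [a ? ?|a ? ?|n]; rewrite ?mr ?tr ?mr //.
move: y'; apply: eq_linear_malg => [a ? ?|a ? ?|n']; rewrite ?ml ?tr ?ml //.
by rewrite -!malgU_mul !tensU -malgU_mul pair_mmulE.
Qed.

Lemma tens_ind (P : {malg K[(M * N)%type]} -> Prop) :
  P 0 -> (forall m n, P (tens << m >> << n >>)) ->
  (forall a x y, P x -> P y -> P (a *: x + y)) -> forall x, P x.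
Proof. by move=> P0 PU; apply: malg_lin_ind => // -[m n]; rewrite -tensU. Qed.

End ProductMonoid.
End MonoidAlgebra.

(** * Sequences under the Cauchy product *)

Section CauchyProduct.
Variable R : nzRingType.
Implicit Types f g h : nat -> R.

Definition cauchy f g (n : nat) : R := \sum_(i < n.+1) f i * g (n - i)%N.
Local Infix "**" := cauchy (at level 40, left associativity).

Definition unit_seq (n : nat) : R := (n == 0%N)%:R.
Definition alt f (n : nat) : R := (-1) ^+ n * f n.

Lemma cauchy_coef n f g (p q : {poly R}) :
  (forall i, (i <= n)%N -> p`_i = f i) -> (forall i, (i <= n)%N -> q`_i = g i) ->
  (p * q)`_n = (f ** g) n.
Proof.
move=> pf qg; rewrite coefM; apply: eq_bigr => i _.
by rewrite pf ?qg ?leq_subr // -ltnS.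
Qed.

Lemma cauchyA f g h : f ** (g ** h) = (f ** g) ** h.
Proof.
apply: functional_extensionality => n.
pose t u : {poly R} := \poly_(i < n.+1) u i.
have tE u i : (i <= n)%N -> (t u)`_i = u i by rewrite coef_poly ltnS => ->.
have tM u v i : (i <= n)%N -> (t u * t v)`_i = (u ** v) i.
  by move=> i_n; apply: cauchy_coef => j j_i; rewrite tE // (leq_trans j_i).
by rewrite -(cauchy_coef (tE f) (tM g h)) mulrA (cauchy_coef (tM f g) (tE h)).
Qed.

Lemma cauchy1l f : unit_seq ** f = f.
Proof.
apply: functional_extensionality => n.
rewrite /cauchy big_ord_recl subn0 mul1r big1 ?addr0 // => i _.
by rewrite mul0r.
Qed.

Lemma cauchy1r f : f ** unit_seq = f.
Proof.
apply: functional_extensionality => n.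
rewrite /cauchy big_ord_recr subnn mulr1 big1 /= ?add0r // => i _.
by rewrite /unit_seq subn_eq0 leqNgt ltn_ord mulr0.
Qed.

Lemma cauchyI f g h : f 0%N = 1 -> f ** g = f ** h -> g = h.
Proof.
move=> f0 fgh; apply: functional_extensionality => n.
elim/ltn_ind: n => n IH; have := congr1 (@^~ n) fgh.
rewrite /cauchy !big_ord_recl f0 !mul1r subn0.
under eq_bigr => i _ do rewrite IH /= ?subnSK ?leq_subr //.
by move/addIr.
Qed.

Lemma cauchy_alt f g : alt (f ** g) = alt f ** alt g.
Proof.
apply: functional_extensionality => n; rewrite /alt /cauchy mulr_sumr.
apply: eq_bigr => i _.
rewrite -[X in _ ^+ X](@subnKC i n) -1?ltnS // exprD -!mulrA; congr (_ * _).
by rewrite !mulrA -commr_sign.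
Qed.

Lemma altK f : alt (alt f) = f.
Proof. by apply: functional_extensionality => n; rewrite /alt mulrA -exprD addnn -muln2 exprM sqrr_sign mul1r. Qed.

Lemma alt0 f : alt f 0 = f 0%N.
Proof. by rewrite /alt mul1r. Qed.

Lemma alt_unit : alt unit_seq = unit_seq.
Proof. by apply: functional_extensionality => -[|n]; rewrite /alt /unit_seq ?mul1r // mulr0. Qed.

Lemma cauchy0 f g : (f ** g) 0%N = f 0%N * g 0%N.
Proof. by rewrite /cauchy big_ord_recl big_ord0 addr0. Qed.

Lemma cauchy_comm f g : (forall i j, f i * g j = g j * f i) -> f ** g = g ** f.
Proof.
move=> fg; apply: functional_extensionality => n.
rewrite /cauchy (reindex_inj rev_ord_inj); apply: eq_bigr => i _ /=.
by rewrite subSS fg subKn // -ltnS.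
Qed.

Lemma left_inverse_is_right f g : f 0%N = 1 -> f ** g = unit_seq -> g ** f = unit_seq.
Proof.
move=> f0 fg; apply: (cauchyI f0).
by rewrite cauchyA fg cauchy1l cauchy1r.
Qed.

Lemma cauchy_factor a b t1 t2 h1 h2 :
  a ** t1 = h1 -> b ** t2 = h2 -> (forall i j, t1 i * b j = b j * t1 i) ->
  (a ** b) ** (t1 ** t2) = h1 ** h2.
Proof.
move=> <- <- tb; rewrite -!cauchyA; congr (_ ** _).
by rewrite !cauchyA (cauchy_comm tb).
Qed.

Lemma cauchy_cancelr f g h h' : h ** f = h' ** f -> f ** g = unit_seq -> h = h'.
Proof. by move=> e fg; rewrite -[h]cauchy1r -[h']cauchy1r -fg !cauchyA e. Qed.

Definition left_inv_step f (s : seq R) :=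
  rcons s (- \sum_(i < size s) s`_i * f (size s - i)%N).

Definition left_inv f (n : nat) : R := (iter n (left_inv_step f) [:: 1])`_n.

Lemma left_inv0 f : left_inv f 0 = 1.
Proof. by []. Qed.

Lemma left_invP f : f 0%N = 1 -> left_inv f ** f = unit_seq.
Proof.
move=> f0; pose s n := iter n (left_inv_step f) [:: 1].
have ss n : size (s n) = n.+1 by elim: n => //= n IH; rewrite size_rcons IH.
have sE m n : (n <= m)%N -> (s m)`_n = left_inv f n.
  elim: m => [|m IH]; first by rewrite leqn0 => /eqP->.
  rewrite leq_eqVlt => /orP[/eqP->//|]; rewrite ltnS => n_m.
  by rewrite /= nth_rcons ss ltnS n_m IH.
apply: functional_extensionality => -[|n].
  by rewrite cauchy0 f0 mulr1.
rewrite /cauchy big_ord_recr /= subnn f0 mulr1 /left_inv /= nth_rcons ss ltnn eqxx.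
rewrite [X in - X](eq_bigr (fun i : 'I_n.+1 => left_inv f i * f (n.+1 - i)%N)).
  by rewrite subrr.
by move=> i _; rewrite sE // -ltnS.
Qed.

End CauchyProduct.

Lemma cauchy_morph (R S : nzRingType) (h : R -> S) (f g : nat -> R) :
  h 0 = 0 -> {morph h : x y / x + y} -> {morph h : x y / x * y} ->
  (fun n => h (cauchy f g n)) = cauchy (fun n => h (f n)) (fun n => h (g n)).
Proof.
move=> h0 hD hM; apply: functional_extensionality => n.
by rewrite /cauchy (big_morph h hD h0); apply: eq_bigr => i _; apply: hM.
Qed.

Lemma cauchy_antimorph (R S : nzRingType) (h : R -> S) (f g : nat -> R) :
  h 0 = 0 -> {morph h : x y / x + y} -> (forall x y, h (x * y) = h y * h x) ->
  (fun n => h (cauchy f g n)) = cauchy (fun n => h (g n)) (fun n => h (f n)).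
Proof.
move=> h0 hD hM; apply: functional_extensionality => n.
rewrite /cauchy (big_morph h hD h0) (reindex_inj rev_ord_inj); apply: eq_bigr => i _ /=.
by rewrite hM subSS subKn // -ltnS.
Qed.

Lemma cauchy_mul_lr (R : nzRingType) (c d : R) (f g : nat -> R) n :
  cauchy f g n = 0 -> \sum_(k < n.+1) c * f k * (g (n - k)%N * d) = 0.
Proof.
move=> fg0; transitivity (c * cauchy f g n * d); last by rewrite fg0 mulr0 mul0r.
by rewrite /cauchy mulr_sumr mulr_suml; apply: eq_bigr => k _; rewrite !mulrA.
Qed.

Lemma additive_cauchy_mul (R S : nzRingType) (h : R -> S) (f g : nat -> R) t n :
  h 0 = 0 -> {morph h : x y / x + y} ->
  h (cauchy f g n * t) = \sum_(k < n.+1) h (f k * g (n - k)%N * t).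
Proof. by move=> h0 hD; rewrite /cauchy mulr_suml (big_morph h hD h0). Qed.

Lemma additive_mul_cauchy (R S : nzRingType) (h : R -> S) (f g : nat -> R) t n :
  h 0 = 0 -> {morph h : x y / x + y} ->
  h (t * cauchy f g n) = \sum_(k < n.+1) h (t * (f k * g (n - k)%N)).
Proof. by move=> h0 hD; rewrite /cauchy mulr_sumr (big_morph h hD h0). Qed.

Local Infix "**" := cauchy (at level 40, left associativity).

(** * Descents and words *)

Definition shift (k : nat) (d : nat -> bool) (i : nat) : bool := d (k + i)%N.

Definition peak_at (d : nat -> bool) (i : nat) : bool := ~~ d i.-1 && d i.

Fixpoint blocks (b : nat) (p : nat -> bool) (q : word) : bool :=
  if q is a :: q' then
    all (fun i => ~~ p i) (iota b (val a - b)) && blocks b (shift (val a) p) q'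
  else true.

Lemma shift_shift k l d : shift k (shift l d) = shift (l + k) d.
Proof. by apply: functional_extensionality => i; rewrite /shift addnA. Qed.

Lemma shift0 d : shift 0 d = d.
Proof. by apply: functional_extensionality. Qed.

Lemma wsum_cat q r : wsum (q ++ r) = (wsum q + wsum r)%N.
Proof. by rewrite /wsum map_cat sumn_cat. Qed.

Lemma wsum_cons a q : wsum (a :: q) = (val a + wsum q)%N.
Proof. by []. Qed.

Lemma blocks_cat b p q r :
  blocks b p (q ++ r) = blocks b p q && blocks b (shift (wsum q) p) r.
Proof.
elim: q p => [|a q IH] p /=; first by rewrite shift0.
by rewrite IH shift_shift andbA.
Qed.

Lemma eq_blocks b (p p' : nat -> bool) q : {in [pred i | (b <= i)%N], p =1 p'} -> blocks b p q = blocks b p' q.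
Proof.
elim: q p p' => //= a q IH p p' pp; congr (_ && _).
  by apply: eq_in_all => i; rewrite mem_iota => /andP[bi _]; rewrite pp.
by apply: IH => i bi; rewrite /shift pp // inE (leq_trans bi) ?leq_addl.
Qed.

Lemma blocksP b (p : nat -> bool) q : reflect
  (forall i, (b <= i < wsum q)%N -> p i -> exists2 s, s \in psums q & (s <= i < s + b)%N)
  (blocks b p q).
Proof.
elim: q p => [|a q IH] p /=; first by left=> i; rewrite andbC.
apply: (iffP andP) => [[/allP ha /IH hq] i /andP[bi iq] pi|h].
  have [ia|ai] := ltnP i (val a).
    have ii : i \in iota b (val a - b) by rewrite mem_iota bi andTb; move: bi ia; lia.
    by have := ha _ ii; rewrite pi.
  move: iq; rewrite psums_cons wsum_cons; case: q hq {IH} => [|c q] hq.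
    by rewrite addn0 ltnNge ai.
  move=> iq; have [iab|abi] := ltnP i (val a + b).
    by exists (val a); rewrite ?inE ?eqxx // ai.
  have [||s sq /andP[s1 s2]] := hq (i - val a)%N; first by move: abi iq ai; lia.
    by rewrite /shift subnKC.
  exists (val a + s)%N; last by move: s1 s2 ai; lia.
  by rewrite inE map_f ?orbT.
have ge s : s \in psums (a :: q) -> (val a <= s)%N.
  rewrite psums_cons; case: (q) => // c r; rewrite inE => /orP[/eqP->//|/mapP[x _ ->]].
  exact: leq_addr.
split.
  apply/allP => i; rewrite mem_iota => /andP[bi ia]; apply/negP => pi.
  have bi' : (b <= i < wsum (a :: q))%N by rewrite wsum_cons bi /=; move: bi ia; lia.
  by have [s /ge sa /andP[si _]] := h i bi' pi; move: bi ia sa si => /=; lia.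
apply/IH => i /andP[bi iq] pi.
have bi' : (b <= val a + i < wsum (a :: q))%N by rewrite wsum_cons /=; move: bi iq; lia.
have [s sq /andP[s1 s2]] := h (val a + i)%N bi' pi.
move: sq; rewrite psums_cons; case: q iq {IH ge h bi'} => [|c q] iq; rewrite ?inE //.
case/orP => [/eqP sa|/mapP[x xq sx]]; first by move: s1 s2; rewrite sa /=; lia.
by exists x => //; move: s1 s2; rewrite sx /=; lia.
Qed.

(* The coefficients of E^i * Xi^(m.+1 - i) at a permutation with descents d: two
   consecutive i contribute if d has no peak, and none otherwise. *)
Lemma sum_hooks (R : comNzRingType) (c : R) m d :
  \sum_(i < m.+2) c ^+ i *
     (all d (iota 1 i.-1) && all (fun j => ~~ shift i d j) (iota 1 (m.+1 - i).-1))%:R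
  = (1 + c) * c ^+ count d (iota 1 m) * (all (fun j => ~~ peak_at d j) (iota 2 m.-1))%:R.
Proof.
elim: m d => [|m IH] d.
  by rewrite !big_ord_recl big_ord0 /= !mulr1 addr0 expr0 expr1.
have [d1|/negbTE d1] := boolP (d 1%N).
  rewrite big_ord_recl /= {1}/shift add0n d1 /= mulr0 add0r add1n.
  have -> : count d (iota 2 m) = count (shift 1 d) (iota 1 m).
    by rewrite (iotaDl 1 1) count_map.
  have -> : all (fun j => ~~ peak_at d j) (iota 2 m) =
            all (fun j => ~~ peak_at (shift 1 d) j) (iota 2 m.-1).
    case: m {IH} => // m; rewrite /= {1}/peak_at d1 /= (iotaDl 1 2) all_map.
    apply: eq_in_all => -[|j]; rewrite ?mem_iota //= => _.
  rewrite exprS [c * c ^+ _]mulrC mulrA -mulrA [c * _]mulrC mulrA -IH mulr_suml.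
  apply: eq_bigr => i _; rewrite /bump /= add1n exprS subSS -mulrA [RHS]mulrC.
  congr (_ * (_ * (_ && _)%:R)).
  case: (val i) => //= k; rewrite d1 /= (iotaDl 1 1) all_map.
  by apply: eq_all => j.
rewrite !big_ord_recl /= big1 => [|i _]; last by rewrite /bump /= d1 mulr0.
rewrite addr0 expr0 expr1 shift0 d1 /= add0n.
have allE k : all (fun j => ~~ peak_at d j) (iota 2 k) = all (fun j => ~~ d j) (iota 2 k).
  elim: k => // k; rewrite -[k.+1]addn1 iotaD !all_cat /= !andbT => ->.
  case: allP => //= hk; rewrite /peak_at add2n /=.
  case: k hk => [|k] hk; first by rewrite d1.
  by rewrite hk ?mem_iota //; lia.
have -> : all (fun j => ~~ shift 1 d j) (iota 1 m) = all (fun j => ~~ d j) (iota 2 m).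
  by rewrite (iotaDl 1 1) all_map.
rewrite allE; case: (boolP (all _ _)) => [dN|]; last by rewrite !mulr0 !addr0.
rewrite (_ : count d _ = 0%N) ?mulr0 ?addr0 ?expr0 ?mulr1 //.
by apply/eqP; rewrite -leqn0 leqNgt -has_count -all_predC.
Qed.

(** * The series T(t) over the free algebra *)

Section FreeAlgebra.
Variable K : fieldType.
Local Notation A := {malg K[{fmonom pos}]}.
Local Notation B := {malg K[({fmonom pos} * {fmonom pos})%type]}.

Definition Hseq (n : nat) : A := if insub n is Some p then << fmu (p : pos) >> else 1.

Lemma Hseq0 : Hseq 0 = 1.
Proof. by rewrite /Hseq insubN. Qed.

Lemma Hseq_val (p : pos) : Hseq (val p) = << fmu p >>.
Proof. by rewrite /Hseq valK. Qed.

Lemma altE (M : monomType) (f : nat -> {malg K[M]}) n : alt f n = (-1) ^+ n *: f n.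
Proof. by rewrite /alt -(signr_odd {malg K[M]}) -(signr_odd K) mulr_sign; case: odd; rewrite ?scaleN1r ?scale1r. Qed.

Lemma linear_alt (M N : monomType) (h : {malg K[M]} -> {malg K[N]}) f :
  linear h -> (fun n => h (alt f n)) = alt (fun n => h (f n)).
Proof.
move=> hl; apply: functional_extensionality => n; rewrite !altE.
exact: linear_scale.
Qed.

(* The coefficients of E(t) = H(-t)^-1 and T(t) = E(t) H(t), where H(t) is the
   generating series of the letters of the free algebra, i.e. of the Xi^n. *)
Definition Eseq : nat -> A := left_inv (alt Hseq).
Definition Tseq : nat -> A := Eseq ** Hseq.
Definition Tword (q : word) : A := \prod_(i <- q) Tseq (val i).

Lemma Eseq_alt : Eseq ** alt Hseq = unit_seq A.
Proof. by apply: left_invP; rewrite alt0 Hseq0. Qed.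

Lemma alt_Eseq : alt Hseq ** Eseq = unit_seq A.
Proof. by apply: left_inverse_is_right Eseq_alt; apply: left_inv0. Qed.

Lemma Tseq0 : Tseq 0 = 1.
Proof. by rewrite /Tseq cauchy0 /Eseq left_inv0 Hseq0 mulr1. Qed.

Lemma alt_Hseq_Tseq : alt Hseq ** Tseq = Hseq.
Proof. by rewrite /Tseq cauchyA alt_Eseq cauchy1l. Qed.

Lemma Hseq_altT : Hseq ** alt Tseq = alt Hseq.
Proof.
rewrite -[Hseq in Hseq ** _]altK -(cauchy_alt (alt Hseq) Tseq).
exact: congr1 alt_Hseq_Tseq.
Qed.

Lemma Tseq_alt : Tseq ** alt Tseq = unit_seq A.
Proof.
apply: left_inverse_is_right; first by rewrite alt0 Tseq0.
by apply: (@cauchyI _ Hseq _ _ Hseq0); rewrite cauchyA Hseq_altT alt_Hseq_Tseq cauchy1r.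
Qed.

Lemma Tword_cat q r : Tword (q ++ r) = Tword q * Tword r.
Proof. by rewrite /Tword big_cat. Qed.

Lemma Tword_cons a q : Tword (a :: q) = Tseq (val a) * Tword q.
Proof. by rewrite /Tword big_cons. Qed.

(* The value at a permutation of n letters whose descents are given by d, when
   the word q is read as Xi^q. *)
Definition ev (n : nat) (d : nat -> bool) (x : A) : K :=
  lincomb (fun m : {fmonom pos} => ((wsum m == n) && blocks 1 d m)%:R : K^o) x.

Lemma ev_lin n d a x y : ev n d (a *: x + y) = a * ev n d x + ev n d y.
Proof. exact: (@lincomb_lin K K^o). Qed.

Lemma ev0 n d : ev n d 0 = 0.
Proof. exact: (raddf0 (@lincomb K K^o _ _)). Qed.

Lemma evZ n d a x : ev n d (a *: x) = a * ev n d x.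
Proof. by rewrite -[a *: x]addr0 ev_lin ev0 addr0. Qed.

Lemma evD n d x y : ev n d (x + y) = ev n d x + ev n d y.
Proof. by rewrite -[x]scale1r ev_lin mul1r scale1r. Qed.

Lemma ev_sum n d I (r : seq I) (P : pred I) (F : I -> A) :
  ev n d (\sum_(i <- r | P i) F i) = \sum_(i <- r | P i) ev n d (F i).
Proof. exact: (big_morph _ (evD n d) (ev0 n d)). Qed.

Lemma evE n d (m : {fmonom pos}) : ev n d << m >> = ((wsum m == n) && blocks 1 d m)%:R.
Proof. exact: (@lincombU K K^o). Qed.

Lemma ev1 n d : ev n d 1 = (n == 0%N)%:R.
Proof. by rewrite evE fm1 andbT eq_sym. Qed.

Lemma evM n d x y :
  ev n d (x * y) = \sum_(k < n.+1) ev k d x * ev (n - k) (shift k d) y.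
Proof.
move: x; apply: malg_lin_ind => [|m|a x x' Px Px'].
- by rewrite mul0r ev0 big1 // => k _; rewrite ev0 mul0r.
- move: y; apply: malg_lin_ind => [|m'|a y y' Py Py'].
  + by rewrite mulr0 ev0 big1 // => k _; rewrite ev0 mulr0.
  + rewrite -malgU_mul evE fmM wsum_cat blocks_cat.
    under eq_bigr => k _ do rewrite !evE.
    have [mn|nm] := leqP (wsum m) n; last first.
      rewrite (_ : (_ + _ == n)%N = false) ?big1 // => [k _|]; last by lia.
      by rewrite (_ : (wsum m == k) = false) ?mul0r //; have := ltn_ord k; lia.
    rewrite (bigD1 (inord (wsum m))) //= inordK ?ltnS // eqxx /= big1 ?addr0.
      rewrite -natrM mulnb andbCA; congr (_ && (_ && _))%:R; lia.
    move=> k; rewrite -val_eqE /= inordK ?ltnS // => km.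
    by rewrite eq_sym (negbTE km) mul0r.
  rewrite malg_linear_mull ev_lin; apply: etrans (congr2 (fun u v => a * u + v) Py Py') _.
  rewrite mulr_sumr -big_split.
  by apply: eq_bigr => k _; rewrite ev_lin mulrDr mulrCA.
rewrite mulrDl -scalerAl ev_lin; apply: etrans (congr2 (fun u v => a * u + v) Px Px') _.
rewrite mulr_sumr -big_split.
by apply: eq_bigr => k _; rewrite ev_lin mulrDl mulrA.
Qed.

Lemma ev_Hseq n d m :
  ev n d (Hseq m) = ((n == m) && all (fun i => ~~ d i) (iota 1 m.-1))%:R.
Proof.
case: m => [|m]; first by rewrite Hseq0 ev1 andbT.
have -> : Hseq m.+1 = << fmu (exist _ m.+1 isT) >> by rewrite -Hseq_val.
by rewrite evE fmU /= /wsum /= addn0 eq_sym andbT subn1.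
Qed.

Lemma ev_mul_Hseq n d i m (x : A) b : (i <= m)%N ->
  (forall k, ev k d x = ((k == i) && b)%:R) ->
  ev n d (x * Hseq (m - i)) =
  ((n == m) && (b && all (fun j => ~~ shift i d j) (iota 1 (m - i).-1)))%:R.
Proof.
move=> im xi; rewrite evM.
under eq_bigr => k _ do rewrite xi ev_Hseq.
have [i_n|n_i] := leqP i n; last first.
  rewrite (_ : (n == m)%N = false) ?big1 // => [k _|]; last by lia.
  by rewrite (_ : (k == i :> nat) = false) ?mul0r //; have := ltn_ord k; lia.
rewrite (bigD1 (inord i)) //= inordK ?ltnS // eqxx /= big1 ?addr0.
  by rewrite -natrM mulnb andbCA; congr (_ && _)%:R; lia.
move=> k; rewrite -val_eqE /= inordK ?ltnS // => ki.
by rewrite (negbTE ki) mul0r.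
Qed.

Lemma ev_Eseq n d m : ev n d (Eseq m) = ((n == m) && all d (iota 1 m.-1))%:R.
Proof.
elim/ltn_ind: m n => -[|m] IH n; first by rewrite /Eseq left_inv0 ev1 andbT.
have := congr1 (fun f => ev n d (f m.+1)) Eseq_alt; rewrite /= ev0 {1}/cauchy.
rewrite big_ord_recr /= subnn alt0 Hseq0 mulr1 evD ev_sum /=.
have hooks := sum_hooks (-1 : K) m d.
rewrite addrN !mul0r big_ord_recr subnn /= andbT in hooks.
have sgnB i : (i <= m.+1)%N -> (-1) ^+ (m.+1 - i) = (-1) ^+ m.+1 * (-1) ^+ i :> K.
  by move=> im; rewrite -signr_odd oddB // signr_addb !signr_odd.
under eq_bigr => i _.
  rewrite altE -malg_scalerAr evZ (@ev_mul_Hseq _ _ i m.+1 _ (all d (iota 1 i.-1))); last first.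
  - by move=> k; apply: IH.
  - exact: ltnW.
  rewrite sgnB ?(ltnW (ltn_ord i)) // -mulrA.
  over.
have [->|_] /= := eqVneq n m.+1; last by rewrite big1 ?add0r // => i _; rewrite !mulr0.
move: hooks => /(congr1 ( *%R ((-1) ^+ m.+1))).
rewrite mulr0 mulrDr mulrA -expr2 sqrr_sign mul1r mulr_sumr => hooks Em.
exact: addrI (etrans Em (esym hooks)).
Qed.

Lemma ev_Tseq n d m : ev n d (Tseq m) =
  (if m is 0%N then 1 else 2) * ((n == m) && all (fun j => ~~ peak_at d j) (iota 2 (m - 2)))%:R.
Proof.
case: m => [|m]; first by rewrite Tseq0 ev1 andbT mul1r.
rewrite /Tseq /cauchy ev_sum /=.
under eq_bigr => i _.
  rewrite (@ev_mul_Hseq _ _ i m.+1 _ (all d (iota 1 i.-1))); last first.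
  - by move=> k; apply: ev_Eseq.
  - by rewrite -ltnS.
  over.
have [_|_] /= := eqVneq n m.+1; last by rewrite mulr0 big1.
have := sum_hooks (1 : K) m d.
by rewrite expr1n mulr1 subSS subn1 => <-; apply: eq_bigr => i _; rewrite expr1n mul1r.
Qed.

Lemma ev_Tword n d q : ev n d (Tword q) =
  2 ^+ size q * ((wsum q == n) && blocks 2 (peak_at d) q)%:R.
Proof.
elim: q n d => [|a q IH] n d.
  by rewrite /Tword big_nil ev1 mul1r eq_sym andbT.
rewrite Tword_cons evM /=.
under eq_bigr => k _ do rewrite ev_Tseq IH.
have [an|na] := leqP (val a) n; last first.
  rewrite wsum_cons (_ : (_ + _ == n)%N = false) ?mulr0 ?big1 // => [k _|]; last by move: na => /=; lia.
  by rewrite (_ : (k == val a :> nat) = false) ?mulr0 ?mul0r //; have := ltn_ord k; move: na => /=; lia.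
rewrite (bigD1 (inord (val a))) //= inordK ?ltnS // eqxx /= big1 ?addr0; last first.
  move=> k; rewrite -val_eqE /= inordK ?ltnS // => ka.
  by rewrite (negbTE ka) mulr0 mul0r.
rewrite (_ : (if _ is 0%N then _ else _) = 2); last by case: a {an} => -[].
rewrite mulrACA -exprS -natrM mulnb andbCA; congr (_ * (_ && (_ && _))%:R).
  by move: an; rewrite wsum_cons /=; lia.
apply: eq_blocks => -[|i] //= _.
by rewrite /peak_at /shift /= addnS.
Qed.
End FreeAlgebra.

(** * The free algebra and its tensor square inside the permutations *)

Definition desc (n : nat) (s : 'S_n) (i : nat) : bool := (img s i.+1 < img s i)%N.

Section Realization.
Variable K : fieldType.
Local Notation A := {malg K[{fmonom pos}]}.
Local Notation B := {malg K[({fmonom pos} * {fmonom pos})%type]}.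
Local Notation T s := (Tagged (fun n => 'S_n) s).

Definition realize (x : A) : KS K := lincomb (fun m : {fmonom pos} => Xiw K m) x.
Definition realize2 (t : B) : KS2 K :=
  lincomb (fun p : {fmonom pos} * {fmonom pos} => Xiw2 K (p.1 : word, p.2 : word)) t.

HB.instance Definition _ := GRing.Linear.copy realize
  (lincomb (fun m : {fmonom pos} => Xiw K m)).
HB.instance Definition _ := GRing.Linear.copy realize2
  (lincomb (fun p : {fmonom pos} * {fmonom pos} => Xiw2 K (p.1 : word, p.2 : word))).

Lemma realize_lin : linear realize. Proof. exact: lincomb_lin. Qed.
Lemma realize2_lin : linear realize2. Proof. exact: lincomb_lin. Qed.

Lemma realizeU (m : {fmonom pos}) : realize << m >> = Xiw K m.
Proof. exact: lincombU. Qed.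

Lemma realize2U p : realize2 << p >> = Xiw2 K (p.1 : word, p.2 : word).
Proof. exact: lincombU. Qed.

Lemma realize1 : realize 1 = KS1 K.
Proof. by rewrite realizeU fm1 Xiw_nil. Qed.

Definition word_coords (x : A) : {malg K[word]} :=
  lincomb (fun m : {fmonom pos} => << (m : word) >>) x.

Definition word2_coords (t : B) : {malg K[(word * word)%type]} :=
  lincomb (fun p : {fmonom pos} * {fmonom pos} => << (p.1 : word, p.2 : word) >>) t.

Lemma coords_realize x : coords (Xiw K) (realize x) = word_coords x.
Proof.
have -> : realize x = lincomb (Xiw K) (word_coords x).
  by rewrite lincomb_lincomb; apply: eq_lincomb => m; rewrite lincombU.
by rewrite coordsK //; apply: Xiw_free.
Qed.

Lemma coords_realize2 t : coords (Xiw2 K) (realize2 t) = word2_coords t.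
Proof.
have -> : realize2 t = lincomb (Xiw2 K) (word2_coords t).
  by rewrite lincomb_lincomb; apply: eq_lincomb => m; rewrite lincombU.
by rewrite coordsK //; apply: Xiw2_free.
Qed.

Lemma word_coords_inj : injective word_coords.
Proof.
apply: (can_inj (g := lincomb (fun q : word => << FMonom q >>))) => x.
rewrite lincomb_lincomb -[RHS]lincomb_id; apply: eq_lincomb => m.
by rewrite lincombU; case: m.
Qed.

Lemma realize_inj : injective realize.
Proof. by move=> x y /(congr1 (coords (Xiw K))); rewrite !coords_realize => /word_coords_inj. Qed.

Lemma descentP x : descent x <-> exists a, x = realize a.
Proof.
rewrite (Xiw_basis K).2; split=> -[c ->].
  exists (lincomb (fun q : word => << FMonom q >>) c).
  by rewrite /realize lincomb_lincomb; apply: eq_lincomb => q; rewrite lincombU.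
exists (word_coords c).
by rewrite /word_coords lincomb_lincomb; apply: eq_lincomb => m; rewrite lincombU.
Qed.

Lemma lincomb_coords_realize (V : lmodType K) (v : word -> V) x :
  lincomb v (coords (Xiw K) (realize x)) = lincomb (fun m : {fmonom pos} => v m) x.
Proof.
rewrite coords_realize lincomb_lincomb; apply: eq_lincomb => m.
by rewrite lincombU.
Qed.

Lemma lincomb_coords_realize2 (V : lmodType K) (v : word * word -> V) t :
  lincomb v (coords (Xiw2 K) (realize2 t)) =
  lincomb (fun p : {fmonom pos} * {fmonom pos} => v (p.1 : word, p.2 : word)) t.
Proof.
rewrite coords_realize2 lincomb_lincomb; apply: eq_lincomb => m.
by rewrite lincombU.
Qed.

Lemma realizeM x y : star (realize x) (realize y) = realize (x * y).
Proof.
rewrite /star lincomb_coords_realize.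
under eq_lincomb => q do rewrite lincomb_coords_realize.
move: x; apply: eq_linear_malg => [|a x z|m].
- exact: lincomb_lin.
- by rewrite malg_linear_mulr realize_lin.
rewrite lincombU; move: y; apply: eq_linear_malg => [|a x z|m'].
- exact: lincomb_lin.
- by rewrite malg_linear_mull realize_lin.
by rewrite lincombU -malgU_mul realizeU fmM.
Qed.

Lemma tensor_linl y : linear (fun x : KS K => tensor x y).
Proof.
move=> a x z; apply/malgP => -[u v].
apply: etrans (tensor_coef _ _ _ _) _; rewrite [RHS]mcoeffD [X in _ = X + _]mcoeffZ.
apply: etrans _ (esym (congr2 (fun s t => a * s + t) (tensor_coef _ _ _ _) (tensor_coef _ _ _ _))).
by rewrite mcoeffD mcoeffZ mulrDl mulrA.
Qed.

Lemma tensor_linr x : linear (fun y : KS K => tensor x y).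
Proof.
move=> a y z; apply/malgP => -[u v].
apply: etrans (tensor_coef _ _ _ _) _; rewrite [RHS]mcoeffD [X in _ = X + _]mcoeffZ.
apply: etrans _ (esym (congr2 (fun s t => a * s + t) (tensor_coef _ _ _ _) (tensor_coef _ _ _ _))).
by rewrite mcoeffD mcoeffZ mulrDr mulrCA.
Qed.

Lemma realize2_tens x y : realize2 (tens x y) = tensor (realize x) (realize y).
Proof.
move: x; apply: eq_linear_malg => [a x z|a x z|m].
- by rewrite tens_linearl realize2_lin.
- by rewrite realize_lin tensor_linl.
move: y; apply: eq_linear_malg => [a x z|a x z|m'].
- by rewrite tens_linearr realize2_lin.
- by rewrite realize_lin tensor_linr.
by rewrite tensU realize2U !realizeU.
Qed.

Lemma realize2M t u : star2 (realize2 t) (realize2 u) = realize2 (t * u).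
Proof.
rewrite /star2 lincomb_coords_realize2.
under eq_lincomb => q do rewrite lincomb_coords_realize2.
move: t; apply: eq_linear_malg => [|a x z|m].
- exact: lincomb_lin.
- by rewrite malg_linear_mulr realize2_lin.
rewrite lincombU; move: u; apply: eq_linear_malg => [|a x z|m'].
- exact: lincomb_lin.
- by rewrite malg_linear_mull realize2_lin.
by rewrite lincombU -malgU_mul realize2U /= !star_Xiw /Xiw2 /= !fmM.
Qed.

Definition coprodH (n : nat) : B := cauchy (fun k => tens (Hseq K k) 1) (fun k => tens 1 (Hseq K k)) n.

Definition coprod : A -> B := malg_ext (fun p : pos => coprodH (val p)).

Lemma coprod_lin : linear coprod. Proof. exact: lincomb_lin. Qed.

Lemma coprodM : {morph coprod : x y / x * y}. Proof. exact: malg_extM. Qed.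

Lemma coprod_Hseq n : coprod (Hseq K n) = coprodH n.
Proof.
case: n => [|n].
  by rewrite Hseq0 /coprod malg_ext1 /coprodH cauchy0 Hseq0 -tensM !mulr1 tens1.
have -> : Hseq K n.+1 = << fmu (exist _ n.+1 isT) >> by rewrite -Hseq_val.
by rewrite /coprod malg_extU.
Qed.

Lemma Xin0 : Xin K 0 = KS1 K.
Proof.
rewrite -Xiw_nil /Xiw /Xin; congr Xi; apply/setP => -[]//.
Qed.

Lemma realize_Hseq n : realize (Hseq K n) = Xin K n.
Proof.
case: n => [|n]; first by rewrite Hseq0 realize1 Xin0.
have -> : Hseq K n.+1 = << fmu (exist _ n.+1 isT) >> by rewrite -Hseq_val.
by rewrite realizeU fmU Xiw1.
Qed.

Lemma realize2_coprodH n : realize2 (coprodH n) = copn K n.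
Proof.
rewrite /coprodH /cauchy raddf_sum; apply: eq_bigr => i _ /=.
by rewrite -tensM mul1r mulr1 realize2_tens !realize_Hseq.
Qed.

Lemma cop_realize x : cop (realize x) = realize2 (coprod x).
Proof.
rewrite /cop lincomb_coords_realize; move: x; apply: eq_linear_malg => [|a x y|m].
- exact: lincomb_lin.
- by rewrite coprod_lin realize2_lin.
rewrite lincombU /coprod malg_extE /copw; elim: (m : seq pos) => [|i q IH].
  by rewrite !big_nil -realize1 -realize2_tens tens1.
by rewrite !big_cons IH -[RHS]realize2M realize2_coprodH.
Qed.

Lemma realize_coef x n (s : 'S_n) : (realize x)@_(T s) = ev n (desc s) x.
Proof.
move: x; apply: (@eq_linear_malg _ _ K^o (fun x => (realize x)@_(T s)) (ev n (desc s))).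
- by move=> a x y; rewrite realize_lin mcoeffD mcoeffZ.
- exact: ev_lin.
move=> m; rewrite realizeU evE /Xiw; case: m => q /=.
have [qn|] /= := eqVneq (wsum q) n; last by move/Xi_coef0->.
subst n; rewrite Xi_coef; congr (_%:R); congr nat_of_bool.
apply/subsetP/blocksP => [sub i /andP[i0 iq] di|h i]; last first.
  rewrite !inE => /andP[i0 di].
  have [|t tq] := h i _ di; first by rewrite i0 ltn_ord.
  by rewrite addn1 ltnS -eqn_leq => /eqP ti; move: tq; rewrite ti.
have := sub (Ordinal iq); rewrite !inE /= i0 => /(_ di) iq'.
by exists i; rewrite // leqnn addn1 ltnS leqnn.
Qed.

Lemma counit_realize x : counit (realize x) = x@_mone.
Proof.
rewrite /counit realize_coef.
move: x; apply: (@eq_linear_malg _ _ K^o (ev 0 _) (mcoeff _)).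
- exact: ev_lin.
- by move=> a x y; rewrite mcoeffD mcoeffZ.
move=> m; rewrite evE mcoeffU1 -val_eqE /= fm1; case: m => -[|[p p0] q] //=.
by rewrite wsum_cons /= addn_eq0 (gtn_eqF p0).
Qed.

End Realization.

(** * Coproduct and antipode *)

Section Antipode.
Variable K : fieldType.
Local Notation A := {malg K[{fmonom pos}]}.
Local Notation B := {malg K[({fmonom pos} * {fmonom pos})%type]}.

Definition emb1 (x : A) : B := tens x 1.
Definition emb2 (x : A) : B := tens 1 x.

Lemma emb1_lin : linear emb1. Proof. exact: tens_linearl. Qed.
Lemma emb2_lin : linear emb2. Proof. exact: tens_linearr. Qed.
Lemma emb1M : {morph emb1 : x y / x * y}.
Proof. by move=> x y; rewrite /emb1 -tensM mulr1. Qed.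
Lemma emb2M : {morph emb2 : x y / x * y}.
Proof. by move=> x y; rewrite /emb2 -tensM mulr1. Qed.
Lemma emb12 x y : emb1 x * emb2 y = tens x y.
Proof. by rewrite /emb1 /emb2 -tensM mulr1 mul1r. Qed.
Lemma emb_comm x y : emb1 x * emb2 y = emb2 y * emb1 x.
Proof. by apply: etrans (emb12 _ _) _; rewrite /emb1 /emb2 -tensM mulr1 mul1r. Qed.

Lemma coprod_Tseq_cauchy :
  (fun n => coprod (Tseq K n)) = (fun n => emb1 (Tseq K n)) ** (fun n => emb2 (Tseq K n)).
Proof.
pose H1 n := emb1 (Hseq K n); pose H2 n := emb2 (Hseq K n).
pose T1 n := emb1 (Tseq K n); pose T2 n := emb2 (Tseq K n).
have morph (h : A -> B) : linear h -> {morph h : x y / x * y} ->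
    alt (fun n => h (Hseq K n)) ** (fun n => h (Tseq K n)) = fun n => h (Hseq K n).
  move=> hl hM.
  apply: etrans (congr1 (fun f n => h (f n)) (alt_Hseq_Tseq K)).
  apply: esym; apply: etrans (cauchy_morph _ _ _ _ hM) _.
  - exact: linear_zero.
  - exact: linear_add.
  by rewrite (linear_alt (Hseq K) hl).
have DH : (fun n => coprod (Hseq K n)) = H1 ** H2.
  by apply: functional_extensionality => n; rewrite coprod_Hseq.
have H10 : H1 0%N = 1 by rewrite /H1 Hseq0 /emb1 tens1.
have H20 : H2 0%N = 1 by rewrite /H2 Hseq0 /emb2 tens1.
apply: (@cauchyI _ (alt (H1 ** H2))).
  by rewrite alt0 cauchy0 H10 H20 mulr1.
have DT D : (fun n => coprod (Hseq K n)) = D -> alt D ** (fun n => coprod (Tseq K n)) = D.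
  by move=> <-; apply: morph; [apply: coprod_lin | apply: coprodM].
apply: etrans (DT _ DH) (esym _).
apply: etrans (congr1 (fun f => f ** _) (cauchy_alt H1 H2)) _.
apply: cauchy_factor.
- exact: morph emb1_lin emb1M.
- exact: morph emb2_lin emb2M.
move=> i j.
have -> : alt H2 j = emb2 (alt (Hseq K) j).
  by have := congr1 (fun f : nat -> B => f j) (esym (linear_alt (Hseq K) emb2_lin)).
exact: emb_comm.
Qed.

Lemma coprod_Tseq n : coprod (Tseq K n) = \sum_(k < n.+1) tens (Tseq K k) (Tseq K (n - k)).
Proof.
rewrite (congr1 (@^~ n) coprod_Tseq_cauchy); apply: eq_bigr => i _.
exact: emb12.
Qed.

Definition Sseq : nat -> A := left_inv (Hseq K).

Lemma Sseq_Hseq : Sseq ** Hseq K = unit_seq A.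
Proof. by apply: left_invP; rewrite Hseq0. Qed.

Lemma Hseq_Sseq : Hseq K ** Sseq = unit_seq A.
Proof. by apply: left_inverse_is_right Sseq_Hseq; apply: left_inv0. Qed.

Definition anti (x : A) : A :=
  lincomb (fun m : {fmonom pos} => \prod_(i <- rev m) Sseq (val i)) x.

Lemma anti_lin : linear anti. Proof. exact: lincomb_lin. Qed.

Lemma antiU (m : {fmonom pos}) : anti << m >> = \prod_(i <- rev m) Sseq (val i).
Proof. exact: lincombU. Qed.

Lemma anti1 : anti 1 = 1.
Proof. by rewrite antiU fm1 big_nil. Qed.

Lemma antiM x y : anti (x * y) = anti y * anti x.
Proof.
move: x; apply: eq_linear_malg => [a x z|a x z|m].
- by rewrite malg_linear_mulr anti_lin.
- by rewrite anti_lin malg_linear_mull.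
move: y; apply: eq_linear_malg => [a x z|a x z|m'].
- by rewrite malg_linear_mull anti_lin.
- by rewrite anti_lin malg_linear_mulr.
rewrite -malgU_mul; apply: etrans (antiU _) _; rewrite fmM rev_cat big_cat.
by apply: esym; apply: etrans (congr2 *%R (antiU m') (antiU m)) _.
Qed.

Lemma anti_Hseq n : anti (Hseq K n) = Sseq n.
Proof.
case: n => [|n]; first by rewrite Hseq0 anti1.
have -> : Hseq K n.+1 = << fmu (exist _ n.+1 isT) >> by rewrite -Hseq_val.
by rewrite antiU fmU big_seq1.
Qed.

Lemma anti_Tseq n : anti (Tseq K n) = alt (Tseq K) n.
Proof.
suff E : (fun n => anti (Tseq K n)) = alt (Tseq K) by rewrite -E.
have SH := functional_extensionality (fun n => anti (Hseq K n)) _ anti_Hseq.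
have S1 : (fun n => anti (Tseq K n)) ** alt Sseq = Sseq.
  have E0 := congr1 (fun (f : nat -> A) n => anti (f n)) (alt_Hseq_Tseq K).
  have E1 := cauchy_antimorph (alt (Hseq K)) (Tseq K)
    (linear_zero anti_lin) (linear_add anti_lin) antiM.
  have E2 := etrans (linear_alt (Hseq K) anti_lin) (congr1 (@alt A) SH).
  rewrite -E2.
  apply: etrans (esym E1) _.
  apply: etrans E0 _.
  exact: SH.
have S2 : alt (Tseq K) ** alt Sseq = Sseq.
  apply: (@cauchyI _ (Hseq K)); first exact: Hseq0.
  apply: etrans (cauchyA _ _ _) (etrans (congr1 (fun f => f ** _) (Hseq_altT K)) _).
  apply: etrans (esym (cauchy_alt _ _)) (etrans (congr1 (@alt A) Hseq_Sseq) _).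
  apply: etrans (alt_unit A) _.
  exact: esym Hseq_Sseq.
apply: (cauchy_cancelr (etrans S1 (esym S2)) (g := alt (Hseq K))).
apply: etrans (esym (cauchy_alt _ _)) (etrans (congr1 (@alt A) Sseq_Hseq) _).
exact: alt_unit.
Qed.

Definition contract_l (t : B) : A :=
  lincomb (fun p : {fmonom pos} * {fmonom pos} => anti << p.1 >> * << p.2 >>) t.

Definition contract_r (t : B) : A :=
  lincomb (fun p : {fmonom pos} * {fmonom pos} => << p.1 >> * anti << p.2 >>) t.

Lemma contract_l_lin : linear contract_l. Proof. exact: lincomb_lin. Qed.
Lemma contract_r_lin : linear contract_r. Proof. exact: lincomb_lin. Qed.

Lemma contract_l_tens x y : contract_l (tens x y) = anti x * y.
Proof.
move: x; apply: eq_linear_malg => [a x z|a x z|m].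
- by rewrite tens_linearl contract_l_lin.
- by rewrite anti_lin malg_linear_mulr.
move: y; apply: eq_linear_malg => [a x z|a x z|m'].
- by rewrite tens_linearr contract_l_lin.
- by rewrite malg_linear_mull.
by rewrite tensU; apply: lincombU.
Qed.

Lemma contract_r_tens x y : contract_r (tens x y) = x * anti y.
Proof.
move: x; apply: eq_linear_malg => [a x z|a x z|m].
- by rewrite tens_linearl contract_r_lin.
- by rewrite malg_linear_mulr.
move: y; apply: eq_linear_malg => [a x z|a x z|m'].
- by rewrite tens_linearr contract_r_lin.
- by rewrite anti_lin malg_linear_mull.
by rewrite tensU; apply: lincombU.
Qed.

Lemma contract_l_emb (x y z w : A) :
  contract_l (tens x 1 * tens 1 y * tens z w) = anti z * anti x * (y * w).
Proof.
apply: etrans (congr1 (fun t => contract_l (t * _)) (emb12 x y)) _.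
by rewrite -tensM contract_l_tens antiM.
Qed.

Lemma contract_r_emb (x y z w : A) :
  contract_r (tens z w * (tens x 1 * tens 1 y)) = z * x * (anti y * anti w).
Proof.
apply: etrans (congr1 (fun t => contract_r (_ * t)) (emb12 x y)) _.
by rewrite -tensM contract_r_tens antiM.
Qed.

Lemma contract_l_coprodH (a : pos) t : contract_l (coprodH K (val a) * t) = 0.
Proof.
have S0 : (Sseq ** Hseq K) (val a) = 0.
  by apply: etrans (congr1 (fun f => f (val a)) Sseq_Hseq) _; rewrite /unit_seq gtn_eqF ?(valP a).
move: t; apply: (@tens_ind K) => [|m n|c x y Px Py].
- by rewrite mulr0; apply: linear_zero contract_l_lin.
- apply: etrans (additive_cauchy_mul _ _ _ _ (linear_zero contract_l_lin) (linear_add contract_l_lin)) _.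
  apply: etrans (cauchy_mul_lr (anti << m >>) << n >> S0); apply: eq_bigr => k _.
  by apply: etrans (contract_l_emb _ _ _ _) _; rewrite anti_Hseq.
apply: etrans (congr1 contract_l (malg_linear_mull _ _ _ _)) (etrans (contract_l_lin _ _ _) _).
by apply: etrans (congr2 (fun u v => c *: u + v) Px Py) _; rewrite scaler0 addr0.
Qed.

Lemma contract_r_coprodH (a : pos) t : contract_r (t * coprodH K (val a)) = 0.
Proof.
have S0 : (Hseq K ** Sseq) (val a) = 0.
  by apply: etrans (congr1 (fun f => f (val a)) Hseq_Sseq) _; rewrite /unit_seq gtn_eqF ?(valP a).
move: t; apply: (@tens_ind K) => [|m n|c x y Px Py].
- by rewrite mul0r; apply: linear_zero contract_r_lin.
- apply: etrans (additive_mul_cauchy _ _ _ _ (linear_zero contract_r_lin) (linear_add contract_r_lin)) _.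
  apply: etrans (cauchy_mul_lr << m >> (anti << n >>) S0); apply: eq_bigr => k _.
  by apply: etrans (contract_r_emb _ _ _ _) _; rewrite anti_Hseq.
apply: etrans (congr1 contract_r (malg_linear_mulr _ _ _ _)) (etrans (contract_r_lin _ _ _) _).
by apply: etrans (congr2 (fun u v => c *: u + v) Px Py) _; rewrite scaler0 addr0.
Qed.

Lemma coprodU (m : {fmonom pos}) : coprod << m >> = \prod_(i <- (m : seq pos)) coprodH K (val i).
Proof. exact: malg_extE. Qed.

Lemma mcoeff1_fmonom (q : word) :
  (<< FMonom q >> : A)@_mone *: (1 : A) = (if q is [::] then 1 else 0).
Proof.
rewrite mcoeffU1 -val_eqE /= fm1.
by case: q => [|a q] /=; rewrite ?scale1r ?scale0r.
Qed.

Lemma contract_l_coprod x : contract_l (coprod x) = x@_mone *: 1.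
Proof.
move: x; apply: eq_linear_malg => [a x y|a x y|[q]].
- by rewrite coprod_lin contract_l_lin.
- by rewrite mcoeffD mcoeffZ scalerDl scalerA.
rewrite mcoeff1_fmonom coprodU /=; case: q => [|a q].
  by rewrite big_nil -tens1 contract_l_tens anti1 mulr1.
by rewrite big_cons contract_l_coprodH.
Qed.

Lemma contract_r_coprod x : contract_r (coprod x) = x@_mone *: 1.
Proof.
move: x; apply: eq_linear_malg => [a x y|a x y|[q]].
- by rewrite coprod_lin contract_r_lin.
- by rewrite mcoeffD mcoeffZ scalerDl scalerA.
rewrite mcoeff1_fmonom coprodU /=; case/lastP: q => [|q a].
  by rewrite big_nil -tens1 contract_r_tens anti1 mulr1.
by rewrite -cats1 big_cat big_seq1 contract_r_coprodH; case: q.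
Qed.

Definition antipode (x : KS K) : KS K :=
  lincomb (fun q : word => realize (anti << FMonom q >>)) (coords (Xiw K) x).

Lemma antipode_realize x : antipode (realize x) = realize (anti x).
Proof.
rewrite /antipode lincomb_coords_realize; move: x; apply: eq_linear_malg => [|a x y|[m]].
- exact: lincomb_lin.
- by rewrite anti_lin realize_lin.
exact: lincombU.
Qed.

Lemma antipodeP : is_antipode antipode.
Proof.
split.
- by move=> _ /descentP[x ->]; rewrite antipode_realize; apply/descentP; exists (anti x).
- move=> a _ _ /descentP[x ->] /descentP[y ->].
  by rewrite -realize_lin !antipode_realize anti_lin realize_lin.
- move=> _ /descentP[x ->]; rewrite /conv cop_realize lincomb_coords_realize2 counit_realize.
  transitivity (realize (contract_l (coprod x))); last first.
    by rewrite contract_l_coprod -[_ *: 1]addr0 realize_lin linear0 addr0 realize1.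
  rewrite /contract_l (lincomb_apply _ _ (@realize_lin K)); apply: eq_lincomb => p /=.
  by rewrite -!realizeU antipode_realize realizeM.
- move=> _ /descentP[x ->]; rewrite /conv cop_realize lincomb_coords_realize2 counit_realize.
  transitivity (realize (contract_r (coprod x))); last first.
    by rewrite contract_r_coprod -[_ *: 1]addr0 realize_lin linear0 addr0 realize1.
  rewrite /contract_r (lincomb_apply _ _ (@realize_lin K)); apply: eq_lincomb => p /=.
  by rewrite -!realizeU antipode_realize realizeM.
Qed.

End Antipode.

(** * The subalgebra generated by the odd coefficients of T(t) *)

Section OddSubalgebra.
Variable K : fieldType.
Hypothesis two_neq0 : (2 : K) != 0.
Local Notation A := {malg K[{fmonom pos}]}.
Local Notation B := {malg K[({fmonom pos} * {fmonom pos})%type]}.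

Definition odd_ext : {malg K[{fmonom odd_pos}]} -> A :=
  malg_ext (fun i : odd_pos => 2^-1 *: Tseq K (val (val i))).

Lemma odd_ext_lin : linear odd_ext. Proof. exact: lincomb_lin. Qed.
Lemma odd_ext1 : odd_ext 1 = 1. Proof. exact: malg_ext1. Qed.
Lemma odd_extM : {morph odd_ext : x y / x * y}. Proof. exact: malg_extM. Qed.
Lemma odd_extU i : odd_ext << fmu i >> = 2^-1 *: Tseq K (val (val i)).
Proof. exact: malg_extU. Qed.

Definition odd_part (x : A) : Prop := exists c, x = odd_ext c.

Lemma odd_part_subspace : is_subspace odd_part.
Proof.
split; first by exists 0; rewrite (linear_zero odd_ext_lin).
by move=> a _ _ [c ->] [d ->]; exists (a *: c + d); rewrite odd_ext_lin.
Qed.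

Lemma odd_part1 : odd_part 1. Proof. by exists 1; rewrite odd_ext1. Qed.

Lemma odd_partM x y : odd_part x -> odd_part y -> odd_part (x * y).
Proof. by move=> [c ->] [d ->]; exists (c * d); rewrite odd_extM. Qed.

Lemma malg_scaleM (M : monomType) (a b : K) (x y : {malg K[M]}) :
  (a *: x) * (b *: y) = (a * b) *: (x * y).
Proof. by rewrite -scalerAl -malg_scalerAr scalerA. Qed.

Lemma half_twice (x : A) : 2^-1 *: (x + x) = x.
Proof. by rewrite -[x in x + x]scale1r -scalerDl scalerA mulVf // scale1r. Qed.

Lemma Tseq_even_rec (m : nat) : ~~ odd m.+1 ->
  Tseq K m.+1 + Tseq K m.+1 = - \sum_(i < m) Tseq K i.+1 * alt (Tseq K) (m - i).
Proof.
move=> me; have := congr1 (fun f : nat -> A => f m.+1) (Tseq_alt K).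
rewrite /cauchy big_ord_recr big_ord_recl /= subnn alt0 Tseq0 subn0 mul1r mulr1.
have -> : alt (Tseq K) m.+1 = Tseq K m.+1.
  by rewrite altE -signr_odd (negbTE me) scale1r.
rewrite addrAC => /eqP; rewrite addr_eq0 => /eqP ->.
by congr (- _); apply: eq_bigr => i _; rewrite subSS.
Qed.

Lemma odd_part_Tseq n : odd_part (Tseq K n).
Proof.
have Os := odd_part_subspace.
elim/ltn_ind: n => -[|m] IH; first by rewrite Tseq0; apply: odd_part1.
have [mo|me] := boolP (odd m.+1).
  pose i : odd_pos := exist _ (exist _ m.+1 isT) mo.
  exists (2 *: << fmu i >>).
  rewrite (linear_scale odd_ext_lin) odd_extU.
  by rewrite scalerA divff // scale1r.
rewrite -[Tseq K m.+1]half_twice (Tseq_even_rec me); apply: (subspaceZ Os); apply: (subspaceN Os).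
apply: (subspace_sum Os) => i _; apply: odd_partM; first by apply: IH; rewrite ltnS ltn_ord.
by rewrite altE; apply: (subspaceZ Os); apply: IH; rewrite ltnS leq_subr.
Qed.

Lemma odd_part_Tword q : odd_part (Tword K q).
Proof.
rewrite /Tword; apply: (big_ind odd_part) => [|x y|i _]; [exact: odd_part1|exact: odd_partM|].
exact: odd_part_Tseq.
Qed.

Lemma odd_extE (m : {fmonom odd_pos}) :
  odd_ext << m >> = 2^-1 ^+ size m *: Tword K (map val m).
Proof.
apply: etrans (malg_extE _ _) _; rewrite /Tword big_map.
elim: (m : seq odd_pos) => [|i q IH]; first by rewrite !big_nil scale1r.
rewrite !big_cons exprS; apply: etrans (congr1 ( *%R _) IH) _.
exact: malg_scaleM.
Qed.

Lemma odd_part_anti x : odd_part x -> odd_part (anti x).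
Proof.
have Os := odd_part_subspace.
case=> c ->; move: c; apply: malg_lin_ind => [|m|a x' y Px Py].
- by rewrite (linear_zero odd_ext_lin) (linear_zero (@anti_lin K)); apply: Os.1.
- rewrite odd_extE (linear_scale (@anti_lin K)).
  apply: (subspaceZ Os); elim: (map val m) => [|i q IH].
    by rewrite /Tword big_nil anti1; apply: odd_part1.
  rewrite Tword_cons antiM; apply: (odd_partM IH).
  by rewrite anti_Tseq altE; apply: (subspaceZ Os); apply: odd_part_Tseq.
by rewrite odd_ext_lin anti_lin; apply: Os.2.
Qed.

Definition odd_part2 (t : B) : Prop :=
  exists s : seq (A * A),
    (forall p, p \in s -> odd_part p.1 /\ odd_part p.2) /\ t = \sum_(p <- s) tens p.1 p.2.

Lemma odd_part2_tens x y : odd_part x -> odd_part y -> odd_part2 (tens x y).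
Proof.
move=> Ox Oy; exists [:: (x, y)]; rewrite big_seq1; split=> // p.
by rewrite inE => /eqP->.
Qed.

Lemma odd_part2_subspace : is_subspace odd_part2.
Proof.
split; first by exists [::]; rewrite big_nil.
move=> a _ _ [s [Os ->]] [t [Ot ->]].
exists ([seq (a *: p.1, p.2) | p <- s] ++ t); split.
  move=> p; rewrite mem_cat => /orP[/mapP[u us ->]|/Ot //].
  by have [? ?] := Os _ us; split=> //; apply: (subspaceZ odd_part_subspace).
rewrite big_cat big_map scaler_sumr /=; congr (_ + _); apply: eq_bigr => p _.
have tl : linear (fun x : A => tens x p.2) by apply: tens_linearl.
by rewrite (linear_scale tl).
Qed.

Lemma odd_part2M t u : odd_part2 t -> odd_part2 u -> odd_part2 (t * u).
Proof.
have O2 := odd_part2_subspace.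
move=> [s [Os ->]] [r [Or ->]]; rewrite mulr_suml big_seq.
apply: (subspace_sum O2) => p /Os[p1 p2]; rewrite mulr_sumr big_seq.
apply: (subspace_sum O2) => p' /Or[p1' p2']; rewrite -tensM.
by apply: odd_part2_tens; apply: odd_partM.
Qed.

Lemma odd_part2_coprod x : odd_part x -> odd_part2 (coprod x).
Proof.
have O2 := odd_part2_subspace.
case=> c ->; move: c; apply: malg_lin_ind => [|m|a x' y Px Py].
- by rewrite (linear_zero odd_ext_lin) (linear_zero (@coprod_lin K)); apply: O2.1.
- rewrite odd_extE (linear_scale (@coprod_lin K)).
  apply: (subspaceZ O2); elim: (map val m) => [|i q IH].
    rewrite /Tword big_nil /coprod malg_ext1 -tens1.
    by apply: odd_part2_tens; apply: odd_part1.
  rewrite Tword_cons coprodM; apply: (fun h => odd_part2M h IH).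
  rewrite coprod_Tseq; apply: (subspace_sum O2) => k _.
  by apply: odd_part2_tens; apply: odd_part_Tseq.
by rewrite odd_ext_lin coprod_lin; apply: O2.2.
Qed.

Definition long_part (k n : nat) (x : A) : Prop :=
  forall w : {fmonom pos}, x@_w != 0 -> (k <= size w)%N /\ wsum w = n.

Lemma long_part_subspace k n : is_subspace (long_part k n).
Proof.
split=> [w|a x y Lx Ly w]; first by rewrite mcoeff0 eqxx.
rewrite mcoeffD mcoeffZ.
have [->|/Ly//] := eqVneq (y@_w) 0.
have [->|/Lx//] := eqVneq (x@_w) 0.
by rewrite mulr0 addr0 eqxx.
Qed.

Lemma long_partW k k' n x : (k <= k')%N -> long_part k' n x -> long_part k n x.
Proof. by move=> kk Lx w /Lx[h ->]; split=> //; apply: leq_trans h. Qed.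

Lemma long_partU (m : {fmonom pos}) : long_part (size m) (wsum m) << m >>.
Proof. by move=> w; rewrite mcoeffU1; case: (eqVneq m w) => [<-|_] //; rewrite mulr0n eqxx. Qed.

Lemma long_partM k n k' n' x y :
  long_part k n x -> long_part k' n' y -> long_part (k + k') (n + n') (x * y).
Proof.
move=> Lx Ly w; rewrite mcoeff_neq0 => /msuppM_le[u [v []]].
rewrite -!mcoeff_neq0 => /Lx[ku <-] /Ly[kv <-] ->.
by rewrite fmM size_cat leq_add // wsum_cat.
Qed.

Lemma long_part_Hseq n : long_part (0 < n) n (Hseq K n).
Proof.
case: n => [|n].
  by rewrite Hseq0 => w; rewrite mcoeff1; case: (eqVneq w mone) => [->|_]; rewrite ?fm1 // mulr0n eqxx.
have -> : Hseq K n.+1 = << fmu (exist _ n.+1 isT) >> by rewrite -Hseq_val.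
by have := @long_partU (fmu (exist _ n.+1 isT)); rewrite fmU /wsum /= addn0.
Qed.

Lemma Tseq_rec n : Tseq K n = Hseq K n - \sum_(i < n) alt (Hseq K) i.+1 * Tseq K (n - i.+1).
Proof.
have := congr1 (fun f : nat -> A => f n) (alt_Hseq_Tseq K).
rewrite /cauchy big_ord_recl /= alt0 Hseq0 mul1r subn0 => <-.
by rewrite addrK.
Qed.

Lemma long_part_Tseq n : long_part (0 < n) n (Tseq K n).
Proof.
elim/ltn_ind: n => n IH; have Ls := long_part_subspace (0 < n) n.
rewrite Tseq_rec; apply: (subspaceD Ls); first exact: long_part_Hseq.
apply: (subspaceN Ls); apply: (subspace_sum Ls) => i _.
have i_n := ltn_ord i.
have -> : nat_of_bool (0 < n)%N = 1%N by rewrite (leq_ltn_trans (leq0n i)).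
have i_n' : (n - i.+1 < n)%N by lia.
have h := long_partM (@long_part_Hseq i.+1) (IH _ i_n'); rewrite (subnKC i_n) in h.
rewrite altE -scalerAl; apply: (subspaceZ (long_part_subspace _ _)).
by apply: long_partW h; apply: leq_addr.
Qed.

Lemma lead_cancel (h s : A) : h - (s - h) - 2 *: h = - s.
Proof. by rewrite opprB scaler_nat mulr2n addrA [h + h - s]addrC addrK. Qed.

Lemma telescope_mul (x y u v : A) : x * y - u * v = (x - u) * y + u * (y - v).
Proof. by rewrite mulrBl mulrBr addrA subrK. Qed.

Lemma Tseq_odd_lead (a : pos) : odd (val a) ->
  long_part 2 (val a) (Tseq K (val a) - 2 *: << fmu a >>).
Proof.
move=> ao; have Ls := long_part_subspace 2 (val a).
rewrite Tseq_rec -Hseq_val; case: (val a) ao Ls => // m mo Ls.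
have last_term : alt (Hseq K) m.+1 * Tseq K (m.+1 - m.+1) = - Hseq K m.+1.
  by rewrite subnn Tseq0 mulr1 altE -signr_odd mo scaleN1r.
rewrite big_ord_recr [X in _ - (_ + X) - _]last_term lead_cancel; apply: (subspaceN Ls); apply: (subspace_sum Ls) => i _.
have h := long_partM (@long_part_Hseq i.+1) (@long_part_Tseq (m.+1 - i.+1)).
rewrite altE -scalerAl; apply: (subspaceZ Ls).
have i_m := ltn_ord i; rewrite (subnKC (ltnW i_m : (i.+1 <= m.+1)%N)) subSS subn_gt0 i_m in h.
rewrite subSS; exact: h.
Qed.

Lemma long_part_Tword q : long_part (size q) (wsum q) (Tword K q).
Proof.
elim: q => [|a q IH].
  by rewrite /Tword big_nil; have := @long_partU mone; rewrite fm1.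
rewrite Tword_cons; have := long_partM (@long_part_Tseq (val a)) IH.
by rewrite (valP a).
Qed.

Lemma FMonom_cons (a : pos) q : << FMonom (a :: q) >> = << fmu a >> * << FMonom q >> :> A.
Proof.
by rewrite -malgU_mul; congr << _ >>; apply: val_inj; rewrite /= fmM fmU.
Qed.

Lemma Tword_odd_lead (q : word) : all (fun a : pos => odd (val a)) q ->
  long_part (size q).+1 (wsum q) (Tword K q - 2 ^+ size q *: << FMonom q >>).
Proof.
elim: q => [_|a q IH /= /andP[ao /IH Lq]].
  rewrite /Tword big_nil scale1r -fmoneE subrr.
  exact: (long_part_subspace _ _).1.
have Ls := long_part_subspace (size q).+2 (wsum (a :: q)).
rewrite Tword_cons FMonom_cons exprS -malg_scaleM.
rewrite telescope_mul; apply: (subspaceD Ls).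
  exact: long_partM (Tseq_odd_lead ao) (@long_part_Tword q).
rewrite -scalerAl; apply: (subspaceZ Ls).
have := long_partM (@long_partU (fmu a)) Lq.
by rewrite fmU /wsum /= addn0.
Qed.

Lemma Tword_odd_free (I : choiceType) (f : I -> word) (a : I -> K) :
  injective f -> (forall i, all (fun a : pos => odd (val a)) (f i)) ->
  (forall i, a i != 0) -> lin_free (fun i => a i *: Tword K (f i)).
Proof.
move=> f_inj f_odd a0.
have sw (q : word) : (size q <= wsum q)%N.
  by elim: q => // b q IH; rewrite wsum_cons /= -add1n leq_add // (valP b).
pose r i := Tword K (f i) - 2 ^+ size (f i) *: << FMonom (f i) >>.
have TE i j : (Tword K (f j))@_(FMonom (f i)) =
    (r j)@_(FMonom (f i)) + 2 ^+ size (f j) * (j == i)%:R.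
  rewrite -[Tword K (f j)](subrK (2 ^+ size (f j) *: << FMonom (f j) >>)) -/(r j).
  rewrite mcoeffD mcoeffZ mcoeffU1; rewrite (_ : (FMonom (f j) == FMonom (f i)) = (j == i)) //.
  by apply/eqP/eqP => [[/f_inj]|->].
have rL i := Tword_odd_lead (f_odd i).
apply: (@triangular_free _ _ _ _ (fun i => FMonom (f i)) (fun i => (wsum (f i) - size (f i))%N)).
  move=> i; rewrite mcoeffZ TE eqxx mulr1 mulf_neq0 //.
  have [->|/rL[/=]] := eqVneq (r i)@_(FMonom (f i)) 0; last by rewrite ltnn.
  by rewrite add0r expf_neq0.
move=> i j; rewrite mcoeffZ TE mulf_eq0 (negbTE (a0 j)) /=.
have [->|ji] := eqVneq j i; first by left.
rewrite mulr0 addr0 => /rL[lt eqw]; right.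
have {}lt : (size (f j) < size (f i))%N := lt.
have {}eqw : wsum (f i) = wsum (f j) := eqw.
by move: lt eqw (sw (f i)); lia.
Qed.

End OddSubalgebra.

(** * Peaks *)

Lemma mem_Peak n (s : 'S_n) (i : 'I_n) : (i \in Peak s) = (1 < i)%N && peak_at (desc s) i.
Proof.
rewrite inE; case: (ltnP 1 i) => //= i1.
rewrite /peak_at /desc prednK ?(ltnW i1) // -leqNgt; congr (_ && _).
rewrite ltn_neqAle; case: leqP; rewrite ?andbF ?andbT // => _.
case: i i1 => -[|[|i]] //= i_n _.
have i_n' : (i < n)%N by lia.
rewrite (imgE s (Ordinal i_n')) (imgE s (Ordinal (ltnW i_n))) eqSS.
apply/negP => /eqP/val_inj/perm_inj/(congr1 val) /= /eqP.
by rewrite -[X in X == _]addn0 -addn1 eqn_add2l.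
Qed.

Lemma Peak_gt1 n (s : 'S_n) : Peak s \subset [set i : 'I_n | (1 < i)%N].
Proof. by apply/subsetP => i; rewrite mem_Peak inE => /andP[]. Qed.

Lemma Peak_sparse n (s : 'S_n) i j : i \in Peak s -> j \in Peak s -> val j != i.+1.
Proof.
rewrite !mem_Peak => /andP[_ /andP[_ di]] /andP[_ /andP[dj _]].
by apply/eqP => ji; move: dj; rewrite ji di.
Qed.

Definition Pset (q : word) : {set 'I_(wsum q)} :=
  [set i | has (fun t => (t <= val i < t + 2)%N) (psums q)].

Lemma blocks_Peak q (s : 'S_(wsum q)) :
  blocks 2 (peak_at (desc s)) q = (Peak s \subset Pset q).
Proof.
apply/blocksP/subsetP => [h i|sub i /andP[i1 iq] pi].
  rewrite mem_Peak inE => /andP[i1 pi]; apply/hasP.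
  by have [|t tq ti] := h i _ pi; [rewrite i1 ltn_ord | exists t].
have := sub (Ordinal iq); rewrite mem_Peak inE /= i1 => /(_ pi) /hasP[t tq ti].
by exists t.
Qed.

Lemma Peak_eq0 n (s : 'S_n) :
  (Peak s == set0) = all (fun j => ~~ peak_at (desc s) j) (iota 2 (n - 2)).
Proof.
apply/eqP/allP => [s0 i|h].
  rewrite mem_iota => /andP[i2 i_n]; have i_n' : (i < n)%N by move: i2 i_n; lia.
  have := congr1 (fun A : {set 'I_n} => Ordinal i_n' \in A) s0.
  by rewrite mem_Peak inE i2 => /= ->.
apply/setP => i; rewrite mem_Peak inE; apply/negP => /andP[i1 pi].
by have := h i; rewrite mem_iota pi => /(_ _)/negP; apply => //; have := ltn_ord i; lia.
Qed.

(* The rank that makes the expansion of tXi^q in the Pi^P triangular, with leading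
   term Pi^P for P the set of partial sums of q. *)
Definition weight (n : nat) (P : {set 'I_n}) : nat := \sum_(i in P) (n - i)%N.

Lemma weight_lt n (D P : {set 'I_n}) :
  (forall i j, i \in P -> j \in P -> val j != i.+1) ->
  (forall i, i \in P -> i \in D \/ exists2 j, j \in D & val i = j.+1) ->
  P != D -> (weight P < weight D)%N.
Proof.
move=> sparse shifted PD.
pose pr (i : 'I_n) := Ordinal (leq_ltn_trans (leq_pred i) (ltn_ord i)).
have prP i : i \in P :\: D -> pr i \in D :\: P /\ val i = (pr i).+1.
  rewrite inE => /andP[iD iP]; have [iD'|[j jD ij]] := shifted i iP.
    by rewrite iD' in iD.
  have -> : pr i = j by apply: val_inj; rewrite /= ij.
  split=> //; rewrite inE jD andbT; apply/negP => jP.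
  by have := sparse j i jP iP; rewrite ij eqxx.
have prI : {in P :\: D &, injective pr}.
  by move=> i j /prP[_ ie] /prP[_ je] e; apply: val_inj; rewrite ie je e.
rewrite /weight (big_setID D) [X in (_ < X)%N](big_setID P) setIC /= ltn_add2l.
have [PD0|PD0] := eqVneq (P :\: D) set0.
  rewrite PD0 big_set0; have /set0Pn[i iDP] : D :\: P != set0.
    by apply: contraNneq PD => DP0; rewrite eqEsubset -!setD_eq0 PD0 DP0 eqxx.
  by rewrite (bigD1 i) //= ltn_addr // subn_gt0.
have sub : pr @: (P :\: D) \subset D :\: P.
  by apply/subsetP => _ /imsetP[i /prP[iD _] ->].
rewrite [X in (_ < X)%N](big_setID (pr @: (P :\: D))) /= (setIidPr sub).
apply: leq_trans (leq_addr _ _); rewrite big_imset //=.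
have -> : (\sum_(i in P :\: D) (n - pr i) = \sum_(i in P :\: D) ((n - i) + 1))%N.
  apply: eq_bigr => i /prP[_ ie]; have := ltn_ord i; rewrite ie; lia.
by rewrite big_split /= sum1_card -ltn_subLR // subnn card_gt0.
Qed.

Section PeakAlgebra.
Variable K : fieldType.
Local Notation T s := (Tagged (fun n => 'S_n) s).

Lemma eperm_coef0 n k (t : 'S_n) (s : 'S_k) : n != k -> (eperm K t)@_(T s) = 0.
Proof.
move=> nk; rewrite /eperm mcoeffU -[_ == _ :> perms]/((n == k) && _).
by rewrite (negbTE nk).
Qed.

Lemma Pi_coef n (P : {set 'I_n}) (s : 'S_n) : (Pi K P)@_(T s) = (Peak s == P)%:R.
Proof.
rewrite /Pi raddf_sum /= (eq_bigr (fun t => (t == s)%:R)); last first.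
  by move=> t _; rewrite eperm_coef.
rewrite big_mkcond /= (bigD1 s) //= eqxx big1 ?addr0; last first.
  by move=> t /negbTE->; rewrite if_same.
by case: eqP.
Qed.

Lemma Pi_coef0 n k (P : {set 'I_n}) (s : 'S_k) : n != k -> (Pi K P)@_(T s) = 0.
Proof.
by move=> nk; rewrite /Pi raddf_sum /= big1 // => t _; rewrite eperm_coef0.
Qed.

Lemma Pi_comb_coef n (Q : pred {set 'I_n}) (c : {set 'I_n} -> K) (s : 'S_n) :
  (\sum_(P | Q P) c P *: Pi K P)@_(T s) = if Q (Peak s) then c (Peak s) else 0.
Proof.
rewrite raddf_sum /= big_mkcond (bigD1 (Peak s)) //= big1 ?addr0.
  by rewrite mcoeffZ Pi_coef eqxx mulr1.
move=> P /negbTE PS; rewrite mcoeffZ Pi_coef eq_sym PS mulr0 if_same //.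
Qed.

Lemma Pi_comb_coef0 n k (Q : pred {set 'I_n}) (c : {set 'I_n} -> K) (s : 'S_k) :
  n != k -> (\sum_(P | Q P) c P *: Pi K P)@_(T s) = 0.
Proof.
move=> nk; rewrite raddf_sum /= big1 // => P _.
by rewrite mcoeffZ Pi_coef0 // mulr0.
Qed.

Lemma realize_Tseq n : realize (Tseq K n) = tXin K n.
Proof.
case: n => [|n]; first by rewrite Tseq0 realize1.
apply/malgP => -[k s]; rewrite realize_coef ev_Tseq /tXin /= mcoeffZ; congr (_ * _).
have [kn|nk] /= := eqVneq k n.+1; last by rewrite Pi_coef0 // eq_sym.
by subst k; rewrite Pi_coef Peak_eq0.
Qed.

Lemma realize_Tword q : realize (Tword K q) = tXiw K q.
Proof.
elim: q => [|a q IH]; first by rewrite /Tword /tXiw !big_nil realize1.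
by rewrite Tword_cons -realizeM IH realize_Tseq /tXiw big_cons.
Qed.

Lemma tXiw_Pi q : tXiw K q = \sum_(P : {set 'I_(wsum q)} | P \subset Pset q) 2 ^+ size q *: Pi K P.
Proof.
apply/malgP => -[n s]; rewrite -realize_Tword realize_coef ev_Tword.
have [qn|qn] /= := eqVneq (wsum q) n; last by rewrite Pi_comb_coef0 // mulr0.
by subst n; rewrite Pi_comb_coef blocks_Peak; case: ifP; rewrite ?mulr1 ?mulr0.
Qed.

Lemma peak_part_subspace n : is_subspace (@peak_part K n).
Proof.
split; first by exists (fun=> 0); rewrite big1 // => P _; rewrite scale0r.
move=> a _ _ [c ->] [d ->]; exists (fun P => a * c P + d P).
rewrite scaler_sumr -big_split; apply: eq_bigr => P _ /=.
by rewrite scalerDl scalerA.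
Qed.

Lemma peak_subspace : is_subspace (@peak K).
Proof. exact: dsum_subspace peak_part_subspace. Qed.

Lemma peak_tXiw q : peak (tXiw K q).
Proof.
exists (wsum q).+1, (fun n => if n == wsum q then tXiw K q else 0); split=> [n|]; last first.
  rewrite big_ord_recr /= eqxx big1 ?add0r // => i _.
  by rewrite ltn_eqF.
case: eqP => [->|_]; last exact: (peak_part_subspace n).1.
exists (fun P : {set 'I_(wsum q)} => if P \subset Pset q then 2 ^+ size q else 0); rewrite tXiw_Pi.
apply/malgP => -[k s].
have [qk|qk] := eqVneq (wsum q) k; last by rewrite !Pi_comb_coef0.
by subst k; rewrite !Pi_comb_coef Peak_gt1.
Qed.

Lemma Dset_ind (Q : forall n, {set 'I_n} -> Prop) :
  (forall q, Q (wsum q) (Dset q)) ->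
  forall n (D : {set 'I_n}), D \subset [set i : 'I_n | (0 < i)%N] -> Q n D.
Proof.
move=> HQ n D Dpos; have [q qD] := ex_Dset K Dpos.
have [s sq] := Xiw_pt q.
have qs : (Xiw K q)@_(T s) = 1 by rewrite Xi_coef sq subxx.
have [nq|nq] := eqVneq n (wsum q); last first.
  by move: qs; rewrite qD Xi_coef0 // => /esym/eqP; rewrite oner_eq0.
subst n; have [t tD] : exists t : 'S_(wsum q), Des t = D.
  by apply: ex_Des => i iD; have := subsetP Dpos i iD; rewrite inE.
suff -> : D = Dset q by [].
have b1 (b : bool) : b%:R = 1 :> K -> b by case: b => // /esym/eqP; rewrite oner_eq0.
apply/eqP; rewrite eqEsubset; apply/andP; split; apply: b1.
  by rewrite -tD -Xi_coef -[Xi _ _]/(Xiw K q) qD Xi_coef tD subxx.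
by rewrite -sq -Xi_coef -qD.
Qed.

Section Span.
Hypothesis two_neq0 : (2 : K) != 0.
Variable W : KS K -> Prop.
Hypothesis Ws : is_subspace W.
Hypothesis WT : forall q, W (tXiw K q).

Lemma Pi_eq0 n (P : {set 'I_n}) : (forall s : 'S_n, Peak s != P) -> Pi K P = 0.
Proof. by move=> h; rewrite /Pi big_pred0 // => s; apply/negbTE/h. Qed.

Lemma span_Pi n (P : {set 'I_n}) : P \subset [set i : 'I_n | (0 < i)%N] -> W (Pi K P).
Proof.
have [m] := ubnP (weight P); elim: m => // m IH in n P *; rewrite ltnS => Pm Ppos.
pose Q k (D : {set 'I_k}) := (weight D <= m)%N -> W (Pi K D).
suff HQ : forall q, Q (wsum q) (Dset q) by apply: (Dset_ind HQ Ppos).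
move: n P Pm Ppos => _ _ _ _ q qm.
have DP : Dset q \subset Pset q.
  apply/subsetP => i; rewrite !inE => iq; apply/hasP; exists (val i) => //.
  by rewrite leqnn /= addn2 ltnS leqnSn.
have E : 2 ^- size q *: tXiw K q =
    Pi K (Dset q) + \sum_(P : {set 'I_(wsum q)} | (P \subset Pset q) && (P != Dset q)) Pi K P.
  rewrite tXiw_Pi -scaler_sumr scalerA mulVf ?scale1r ?expf_neq0 //.
  by rewrite (bigD1 (Dset q)).
have -> : Pi K (Dset q) = 2 ^- size q *: tXiw K q -
    \sum_(P : {set 'I_(wsum q)} | (P \subset Pset q) && (P != Dset q)) Pi K P by rewrite E addrK.
apply: (subspaceD Ws); first exact: (subspaceZ Ws).
apply: (subspaceN Ws); apply: (subspace_sum Ws) => P /andP[PP PD].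
have [/existsP[s /eqP sP]|/existsPn h] := boolP [exists s : 'S_(wsum q), Peak s == P]; last first.
  by rewrite Pi_eq0 //; apply: Ws.1.
apply: IH; last first.
  apply/subsetP => i; rewrite -sP => /(subsetP (Peak_gt1 s)); rewrite !inE.
  exact: ltnW.
apply: leq_trans qm; apply: weight_lt => //.
  by move=> i j; rewrite -sP; apply: Peak_sparse.
move=> i iP; have := subsetP PP i iP; rewrite inE => /hasP[t tq /andP[ti it]].
have [ti'|ti'] := eqVneq t (val i); first by left; rewrite inE -ti'.
have tn : (t < wsum q)%N by have /andP[] := psums_pos tq.
by right; exists (Ordinal tn); rewrite ?inE //=; move: ti it ti' => /=; lia.
Qed.

Lemma span_peak x : peak x -> W x.
Proof.
move=> [N [y [yP ->]]]; apply: (subspace_sum Ws) => i _.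
have [c ->] := yP i; apply: (subspace_sum Ws) => P P1.
apply: (subspaceZ Ws); apply: span_Pi; apply: subset_trans P1 _.
by apply/subsetP => j; rewrite !inE; apply: ltnW.
Qed.

End Span.

Lemma peakP (two_neq0 : (2 : K) != 0) (x : KS K) :
  peak x <-> exists2 a, odd_part a & x = realize a.
Proof.
split=> [px|[_ [c ->] ->]].
  apply: (@span_peak two_neq0 (fun x => exists2 a, odd_part a & x = realize a)) px => [|q].
    split; first by exists 0; [exact: (odd_part_subspace K).1 | rewrite linear0].
    move=> a _ _ [u Ou ->] [v Ov ->]; exists (a *: u + v); last by rewrite realize_lin.
    exact: (odd_part_subspace K).2.
  by exists (Tword K q); [apply: odd_part_Tword | rewrite realize_Tword].
have Ps := peak_subspace.
move: c; apply: malg_lin_ind => [|m|a c d Pc Pd].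
- by rewrite (linear_zero (@odd_ext_lin K)) linear0; apply: Ps.1.
- rewrite odd_extE (linear_scale (@realize_lin K)) realize_Tword.
  by apply: (subspaceZ Ps); apply: peak_tXiw.
by rewrite odd_ext_lin realize_lin; apply: Ps.2.
Qed.

End PeakAlgebra.

Theorem theorem3 (K : fieldType) (charK : [pchar K] =i pred0) :
  [/\ is_hopf_subalgebra (@peak K),
      is_basis (fun q : odd_word => tXiw K (val q)) (@peak K),
      forall r q : word, star (tXiw K r) (tXiw K q) = tXiw K (r ++ q),
      forall n : pos,
        cop (tXin K (val n)) =
        \sum_(k < (val n).+1) tensor (tXin K k) (tXin K (val n - k))
    & (forall n : odd_pos,
        2^-1 *: tXin K (val (val n)) =
        \sum_(s : 'S_(val (val n)) | Peak s == set0) eperm K s) /\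
      freely_generated (fun n : odd_pos => 2^-1 *: tXin K (val (val n)))
        (@peak K)].
Proof.
have two_neq0 : (2 : K) != 0 by move/pcharf0P: charK => ->.
have Ps := @peak_subspace K; have pP := peakP two_neq0.
have odd_ext_words c : exists d : {malg K[odd_word]}, odd_ext c = lincomb (fun q : odd_word => Tword K (val q)) d.
  move: c; apply: malg_lin_ind => [|m|a x y [c xc] [d yd]].
  - by exists 0; rewrite (linear_zero (@odd_ext_lin K)) linear0.
  - have mo : all (fun i : pos => odd (val i)) (map val m).
      by rewrite all_map; apply/allP => i _; apply: (valP i).
    exists (2^-1 ^+ size m *: << exist _ (map val m) mo : odd_word >>).
    by rewrite odd_extE linearZ /= lincombU.
  - by exists (a *: c + d); rewrite odd_ext_lin xc yd linearP.
split.
- split.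
  + by split=> // x /pP[a _ ->]; apply/descentP; exists a.
  + by apply/pP; exists 1; [exact: odd_part1 | rewrite realize1].
  + move=> _ _ /pP[a Oa ->] /pP[b Ob ->]; rewrite realizeM; apply/pP.
    by exists (a * b) => //; apply: odd_partM.
  + move=> _ /pP[a Oa ->]; rewrite cop_realize.
    have [s [Os ->]] := odd_part2_coprod two_neq0 Oa.
    exists [seq (realize p.1, realize p.2) | p <- s]; split.
      move=> _ /mapP[p /Os[p1 p2] ->]; split; apply/pP; first by exists p.1.
      by exists p.2.
    rewrite linear_sum big_map; apply: eq_bigr => p _.
    exact: realize2_tens.
  + exists (@antipode K); first exact: antipodeP.
    move=> _ /pP[a Oa ->]; rewrite antipode_realize; apply/pP.
    by exists (anti a) => //; apply: odd_part_anti.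
- have lE d : lincomb (fun q : odd_word => tXiw K (val q)) d =
      realize (lincomb (fun q : odd_word => Tword K (val q)) d).
    by rewrite (lincomb_apply _ _ (@realize_lin K)); apply: eq_lincomb => q; rewrite realize_Tword.
  have free : lin_free (fun q : odd_word => 1 *: Tword K (val q)).
    apply: (@Tword_odd_free K two_neq0 odd_word val (fun=> 1)).
    - exact: val_inj.
    - by move=> q; apply: (valP q).
    - by move=> q; apply: oner_neq0.
  split=> [d|x].
    rewrite lE -(linear0 (@realize K)) => /realize_inj d0.
    by apply: free; apply: etrans d0; apply: eq_lincomb => q; rewrite scale1r.
  rewrite pP; split=> [[_ [c ->] ->]|[d ->]].
    by have [d ->] := odd_ext_words c; exists d.
  by rewrite -pP; apply: (subspace_lincomb _ Ps) => q; apply: peak_tXiw.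
- by move=> r q; rewrite -!realize_Tword realizeM Tword_cat.
- move=> n; rewrite -realize_Tseq cop_realize coprod_Tseq linear_sum; apply: eq_bigr => k _.
  by rewrite -!realize_Tseq; apply: realize2_tens.
split.
  move=> n; rewrite /tXin (gtn_eqF (valP (val n))).
  by rewrite scalerA mulVf // scale1r.
pose subst : {linear {malg K[{fmonom odd_pos}]} -> KS K} :=
  lincomb (fun m : {fmonom odd_pos} => realize (odd_ext << m >>)).
have substE c : subst c = realize (odd_ext c).
  move: c; apply: eq_linear_malg => [a x y|a x y|m]; first by rewrite linearP.
    by rewrite odd_ext_lin realize_lin.
  exact: lincombU.
exists subst; split.
- by rewrite substE odd_ext1 realize1.
- by move=> f h; rewrite !substE odd_extM realizeM.
- by move=> i; rewrite substE odd_extU (linear_scale (@realize_lin K)) realize_Tseq.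
- have free : lin_free (fun m : {fmonom odd_pos} => 2^-1 ^+ size m *: Tword K (map val m)).
    apply: (@Tword_odd_free K two_neq0 {fmonom odd_pos} (fun m => map val m) (fun m => 2^-1 ^+ size m)).
    - by move=> [m] [m'] /= /(inj_map val_inj) ->.
    - by move=> m; rewrite all_map; apply/allP => i _; apply: (valP i).
    - by move=> m; rewrite expf_neq0 // invr_neq0.
  move=> c d; rewrite !substE => /realize_inj cd; apply/eqP; rewrite -subr_eq0; apply/eqP.
  apply: free; apply: etrans (_ : odd_ext (c - d) = 0).
    rewrite -[in RHS](lincomb_id (c - d)) (lincomb_apply _ _ (@odd_ext_lin K)).
    by apply: eq_lincomb => m; rewrite odd_extE.
  by rewrite addrC -scaleN1r odd_ext_lin cd scaleN1r addNr.
- move=> x; rewrite pP; split=> [[_ [c ->] ->]|[c ->]]; first by exists c; rewrite substE.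
  by rewrite substE; exists (odd_ext c) => //; exists c.
Qed.
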